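(* Let $d\ge 1$, let $n=(n_1,\dots,n_d)$ be a $d$-tuple of non-negative integers, and let $p\in\mathbb{C}[z_1,\dots,z_d]$ have degree at most $n_j$ in $z_j$ for each $j$ and have no zeros on the closed polydisk $\overline{\mathbb{D}^d}$. Let $\tilde{p}(z)=z_1^{n_1}\cdots z_d^{n_d}\,\overline{p(1/\bar z_1,\dots,1/\bar z_d)}$ and $$\mathcal{P}(z,\zeta)=\frac{p(z)\overline{p(\zeta)}-\tilde p(z)\overline{\tilde p(\zeta)}}{\prod_{j=1}^d(1-z_j\bar\zeta_j)},\qquad z,\zeta\in\mathbb{D}^d.$$ Then for every nonempty $S\subsetneq\{1,2,\dots,d\}$ there exist $S$-contractive $\mathcal{P}$-kernels $K_S, L_S$ such that if $S\sqcup T=\{1,\dots,d\}$ is a partition with $S$ and $T$ both nonempty, then $$\mathcal{P}=K_S+L_T.$$ Moreover, $K_S$ is maximal among all $S$-contractive kernels bounded above by $\mathcal{P}$; that is, if $K$ is an $S$-contractive positive semi-definite kernel on $\mathbb{D}^d$ with $\mathcal{P}\geq K$, then $K_S\geq K$.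
   Context: A function $K:\mathbb{D}^d\times\mathbb{D}^d\to\mathbb{C}$ is a positive semi-definite kernel, written $K\geq 0$, if for every finite $F\subset\mathbb{D}^d$ the matrix $(K(z,\zeta))_{z,\zeta\in F}$ is positive semi-definite; $K\geq L$ means $K-L\geq 0$. A positive semi-definite kernel $K$ is $j$-contractive if $(1-z_j\bar{\zeta}_j)K(z,\zeta)\geq 0$; for $S\subset\{1,\dots,d\}$, it is $S$-contractive if it is $j$-contractive for every $j\in S$. A function $K:\mathbb{D}^d\times\mathbb{D}^d\to\mathbb{C}$ is called a $\mathcal{P}$-kernel if (i) $\mathcal{P}\geq K\geq 0$, and (ii) for every function $f:\mathbb{D}^d\to\mathbb{C}$, whenever $\mathcal{P}(z,\zeta)\geq f(z)\overline{f(\zeta)}$ and $K(z,\zeta)\geq\epsilon f(z)\overline{f(\zeta)}$ for some $\epsilon>0$, then $K(z,\zeta)\geq f(z)\overline{f(\zeta)}$. *)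

(* Defs.v *)
From HB Require Import structures.
From mathcomp Require Import all_boot all_order all_algebra spectral.
From mathcomp Require Import complex mpoly.
From mathcomp Require Import reals.

Set Implicit Arguments.
Unset Strict Implicit.
Unset Printing Implicit Defensive.

Import Order.TTheory GRing.Theory Num.Theory.
Local Open Scope ring_scope.
Local Open Scope complex_scope.
Local Open Scope sesquilinear_scope.

Definition polydisk (R : realType) (d : nat) : Type :=
  {z : {ffun 'I_d -> R[i]} | [forall j, `|z j| < 1]}.

Definition kernel (R : realType) (d : nat) : Type :=
  polydisk R d -> polydisk R d -> R[i].

(* [0 <= x] in [R[i]] means that [x] is a non-negative real, so this condition
   forces [A] to be Hermitian. *)
Definition psdmx (R : realType) (m : nat) (A : 'M[R[i]]_m) : Prop :=
  forall v : 'cV[R[i]]_m, 0 <= (v ^t* *m A *m v) 0 0.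

(* A finite subset of the polydisk is given by an injective enumeration. *)
Definition psd_kernel (R : realType) (d : nat) (K : kernel R d) : Prop :=
  forall (m : nat) (x : 'I_m -> polydisk R d), injective x ->
    psdmx (\matrix_(i < m, j < m) K (x i) (x j)).

Definition kernel_ge (R : realType) (d : nat) (K L : kernel R d) : Prop :=
  psd_kernel (fun z w => K z w - L z w).

Definition j_contractive (R : realType) (d : nat) (j : 'I_d)
    (K : kernel R d) : Prop :=
  psd_kernel K /\
  psd_kernel (fun z w => (1 - val z j * Num.conj (val w j)) * K z w).

Definition S_contractive (R : realType) (d : nat) (S : {set 'I_d})
    (K : kernel R d) : Prop :=
  forall j, j \in S -> j_contractive j K.

Definition rank1 (R : realType) (d : nat) (f : polydisk R d -> R[i]) :
    kernel R d :=
  fun z w => f z * Num.conj (f w).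

Definition P_kernel (R : realType) (d : nat) (P K : kernel R d) : Prop :=
  [/\ kernel_ge P K, psd_kernel K
    & forall f : polydisk R d -> R[i],
        kernel_ge P (rank1 f) ->
        (exists2 eps : R, 0 < eps &
           kernel_ge K (fun z w => eps%:C * rank1 f z w)) ->
        kernel_ge K (rank1 f)].

Definition mdeg_le (R : realType) (d : nat) (n : 'X_{1..d})
    (p : {mpoly R[i][d]}) : Prop :=
  forall m, m \in msupp p -> forall j, (m j <= n j)%N.

(* The expression z^n * conj (p (1 / conj z)) makes sense only where no
   coordinate vanishes; it is extended to all z as the polynomial obtained by
   sending each term c X^m of p to (conj c) X^(n - m).
   See [meval_reflection]. *)
Definition reflection (R : realType) (d : nat) (n : 'X_{1..d})
    (p : {mpoly R[i][d]}) : {mpoly R[i][d]} :=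
  \sum_(m <- msupp p) Num.conj p@_m *: 'X_[n - m].

Lemma meval_reflection (R : realType) (d : nat) (n : 'X_{1..d})
    (p : {mpoly R[i][d]}) (z : 'I_d -> R[i]) :
  mdeg_le n p -> (forall j, z j != 0) ->
  (reflection n p).@[z] =
    (\prod_j z j ^+ n j) * Num.conj (p.@[fun j => 1 / Num.conj (z j)]).
Proof.
move=> deg_p z_neq0.
rewrite /reflection raddf_sum /= [in RHS]mevalE rmorph_sum /= mulr_sumr.
rewrite [LHS]big_seq [RHS]big_seq; apply: eq_bigr => m m_p.
rewrite mevalZ mevalX rmorphM /= mulrCA; congr (_ * _).
rewrite rmorph_prod /= -big_split /=; apply: eq_bigr => j _.
rewrite rmorphXn /= div1r fmorphV /= conjCK mnmBE exprVn.
by rewrite expfB_cond // (negbTE (z_neq0 j)) add0n; exact: deg_p.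
Qed.

Definition Pker (R : realType) (d : nat) (n : 'X_{1..d})
    (p : {mpoly R[i][d]}) : kernel R d :=
  fun z w =>
    (p.@[val z] * Num.conj (p.@[val w])
       - (reflection n p).@[val z] * Num.conj ((reflection n p).@[val w]))
    / \prod_j (1 - val z j * Num.conj (val w j)).

(* Main.v *)
(** On the torus |p~| = |p|, so phi = p~/p is inner and
    P = p (1 - phi phi^bar) s p^bar with s the Szego kernel; up to the factor p,
    P is the kernel of the model space H^2 - phi H^2.  Let W be the closure of
    the span of the projections to H^2 of z^(-a) p~ Q, where Q is a polynomial
    and z^a a monomial in the variables of S.  The orthogonal complement of W
    in H^2 is the largest subspace of the model space that is invariant under
    the z_j with j in S, and [K S] is its kernel; W - phi H^2 is invariant under
    the other z_j, and gives [L (~: S)].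

    All spaces are closures of spaces of polynomials, so the only pre-Hilbert
    space needed is the space of polynomials with the coefficient inner product.
    A kernel [k] is handled through its quadratic form, which at [v] is the
    supremum of 2 Re <g, v> - |g|^2 over the polynomials [g] of the space with
    kernel [k].  Dividing by p is avoided by the density of p C[z] in H^2, which
    is proved by following the dilations p(rz) from r = 0 to r = 1. *)

Require Import Defs.
From HB Require Import structures.
From mathcomp Require Import all_boot all_order all_algebra spectral.
From mathcomp Require Import cyclic separable cyclotomic complex mpoly.
From mathcomp Require Import reals boolp.
From mathcomp Require Import -(notations) classical_sets topology normedtype.
From mathcomp Require Import -(notations) derive.
From mathcomp Require Import lra ring zify.

Set Implicit Arguments.
Unset Strict Implicit.
Unset Printing Implicit Defensive.

Import Order.TTheory GRing.Theory Num.Theory.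
Local Open Scope ring_scope.
Local Open Scope complex_scope.
Import Normc.

(** * The Hardy space inner product on polynomials *)

(** W has this form because a vector f of H^2 generates an S-invariant subspace of the model space
    exactly when every z^a f, with a in the variables of S, is orthogonal to phi H^2, that is, when
    f is orthogonal to all backward shifts of phi H^2. For j outside S these shifts commute with
    z_j, and phi F0 is orthogonal to z_j W when F0 does not involve z_j. The P-kernel condition
    reflects orthogonality: the two spaces are complements of each other, so a function lying in one
    of them, which is what the eps condition says, has the same norm there as in the sum. The
    obstacle is that f in that condition and the competitor in the maximality claim are arbitrary,
    with no polynomials behind them. Comparisons therefore take place on finite combinations of
    point evaluations, where multiplication acts by its adjoint [mulv] and kernel inequalities are
    inequalities of quadratic forms. Polynomials reach that side only approximately, through
    [approx_poly], so exact Hilbert space identities become inequalities up to a multiple of e,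
    which [ler_addeps] removes. *)

Section Modulus.
Variable R : realType.
Implicit Types (x y z : R[i]) (a b : R).

Lemma normcR z : `|z| = (normc z)%:C.
Proof. by case: z. Qed.

Lemma normc_ge0 z : 0 <= normc z.
Proof. by rewrite -ler0c -normcR. Qed.

Lemma normc_conj z : normc (Num.conj z) = normc z.
Proof. by apply/complexI; rewrite -!normcR norm_conjC. Qed.

Lemma mulc_conj z : z * Num.conj z = (normc z ^+ 2)%:C.
Proof. by rewrite -normCK normcR rmorphXn. Qed.

Lemma Re_le_normc z : complex.Re z <= normc z.
Proof.
by apply: le_trans (ler_norm _) _; rewrite -lecR -normcR; exact: normc_ge_Re.
Qed.

Lemma normcD_le x y : normc (x + y) <= normc x + normc y.
Proof. by rewrite -lecR rmorphD /= -!normcR ler_normD. Qed.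

Lemma normcB_le x y : normc (x - y) <= normc x + normc y.
Proof. by rewrite -lecR rmorphD /= -!normcR ler_normB. Qed.

Lemma normc_distC x y : normc (x - y) = normc (y - x).
Proof. by apply/complexI; rewrite -!normcR distrC. Qed.

Lemma normc_sum_le (I : Type) (s : seq I) (P : pred I) (F : I -> R[i]) :
  normc (\sum_(i <- s | P i) F i) <= \sum_(i <- s | P i) normc (F i).
Proof.
rewrite -lecR -normcR rmorph_sum /=; apply: le_trans (ler_norm_sum _ _ _) _.
by apply: ler_sum => i _; rewrite normcR.
Qed.

Lemma normc_prod (I : Type) (s : seq I) (P : pred I) (F : I -> R[i]) :
  normc (\prod_(i <- s | P i) F i) = \prod_(i <- s | P i) normc (F i).
Proof. by apply: (big_morph _ (@normcM R) (@normc1 R)). Qed.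

Lemma normcX x n : normc (x ^+ n) = normc x ^+ n.
Proof. by elim: n => [|n IH]; rewrite ?expr0 ?normc1 // !exprS normcM IH. Qed.

Lemma normc_real a : normc a%:C = `|a|.
Proof. by rewrite /= expr0n /= addr0 sqrtr_sqr. Qed.

Lemma normc_eq0 z : (normc z == 0) = (z == 0).
Proof. by rewrite -(inj_eq (@complexI R)) -normcR normr_eq0. Qed.

Lemma ReD x y : complex.Re (x + y) = complex.Re x + complex.Re y.
Proof. by case: x; case: y. Qed.
Lemma ReN x : complex.Re (- x) = - complex.Re x.
Proof. by case: x. Qed.
Lemma ReB x y : complex.Re (x - y) = complex.Re x - complex.Re y.
Proof. by rewrite ReD ReN. Qed.
Lemma Re_conj x : complex.Re (Num.conj x) = complex.Re x.
Proof. by case: x. Qed.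
Lemma ReZ a x : complex.Re (a%:C * x) = a * complex.Re x.
Proof. by case: x => b c /=; rewrite mul0r subr0. Qed.
Lemma Re_real a : complex.Re a%:C = a.
Proof. by []. Qed.

Lemma ge0cE z : (0 <= z) = (complex.Im z == 0) && (0 <= complex.Re z).
Proof. by rewrite lecE. Qed.

Lemma quad_bound a n c : 0 <= n -> 0 <= a -> 0 <= c -> (n = 0 -> a = 0) ->
  (forall t, 2 * t * a ^+ 2 <= c ^+ 2 + t ^+ 2 * a ^+ 2 * n ^+ 2) -> a <= c * n.
Proof.
move=> n0 a0 c0 nz H; have [n_eq0|n_neq0] := eqVneq n 0.
  by rewrite nz // mulr_ge0.
have n2_gt0 : 0 < n ^+ 2 by rewrite exprn_gt0 // lt_def n_neq0.
(* The value t = n^-2 maximises 2 t a^2 - t^2 a^2 n^2, the maximum being a^2 / n^2. *)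
have := H (n ^- 2); rewrite -(ler_pM2l n2_gt0).
have -> : n ^+ 2 * (2 * n ^- 2 * a ^+ 2) = 2 * a ^+ 2 by field.
have -> : n ^+ 2 * (c ^+ 2 + (n ^- 2) ^+ 2 * a ^+ 2 * n ^+ 2) =
  c ^+ 2 * n ^+ 2 + a ^+ 2 by field.
move=> {}H; rewrite -ler_sqr ?nnegrE ?mulr_ge0 // exprMn; lra.
Qed.

(** The factor [M] and the cap e <= 1 allow crude estimates: [M] may depend on everything but e, and
    e^2 is absorbed into e. *)
Lemma ler_addeps a b (M : R) :
  (forall e, 0 < e -> e <= 1 -> a <= b + M * e) -> a <= b.
Proof.
move=> H; apply/ler_addgt0Pr => e e0.
have M0 : 0 < `|M| + 1 by rewrite ltr_wpDl.
pose e' := Num.min 1 (e / (`|M| + 1)).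
have e'0 : 0 < e' by rewrite lt_min ltr01 divr_gt0.
apply: le_trans (H e' e'0 _) _; first by rewrite ge_min lexx.
rewrite lerD2l; apply: (@le_trans _ _ ((`|M| + 1) * e')).
  rewrite ler_pM2r //; have := ler_norm M; lra.
by rewrite mulrC -ler_pdivlMr // ge_min lexx orbT.
Qed.
End Modulus.

Section Hardy.
Variables (R : realType) (d : nat).
Local Notation C := R[i].
Local Notation E := {mpoly C[d]}.
Implicit Types (f g h : E) (c : C) (a b m : 'X_{1..d}).

Definition ip f g : C := \sum_(m <- msupp f) f@_m * Num.conj g@_m.
Definition hn f : R := Num.sqrt (complex.Re (ip f f)).

Lemma ip_supp (s : seq 'X_{1..d}) f g : uniq s -> {subset msupp f <= s} ->
  ip f g = \sum_(m <- s) f@_m * Num.conj g@_m.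
Proof.
move=> us sub; rewrite [RHS](bigID (mem (msupp f))) /= [X in _ + X]big1 => [|m].
  rewrite addr0 -big_filter; apply: perm_big.
  apply: uniq_perm; rewrite ?filter_uniq ?msupp_uniq //.
  by move=> m; rewrite mem_filter; case: (boolP (m \in msupp f)) => //= /sub ->.
by move=> nm; rewrite memN_msupp_eq0 // mul0r.
Qed.

Lemma ip_conj f g : ip g f = Num.conj (ip f g).
Proof.
pose s := undup (msupp f ++ msupp g).
have us : uniq s by exact: undup_uniq.
rewrite (@ip_supp s f g) ?(@ip_supp s g f) // => [||].
- rewrite rmorph_sum; apply: eq_bigr => m _.
  by rewrite rmorphM /= conjCK mulrC.
- by move=> m mg; rewrite mem_undup mem_cat mg orbT.
by move=> m mg; rewrite mem_undup mem_cat mg.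
Qed.

Lemma ipDl f g h : ip (f + g) h = ip f h + ip g h.
Proof.
pose s := undup (msupp f ++ msupp g).
have us : uniq s by exact: undup_uniq.
rewrite !(@ip_supp s) // => [||m|].
- by rewrite -big_split /=; apply: eq_bigr => m _; rewrite mcoeffD mulrDl.
- by move=> m mg; rewrite mem_undup mem_cat mg orbT.
- by move=> mg; rewrite mem_undup mem_cat mg.
by move=> m /msuppD_le; rewrite mem_undup.
Qed.

Lemma ipZl c f g : ip (c *: f) g = c * ip f g.
Proof.
rewrite (@ip_supp (msupp f)) ?msupp_uniq //; last exact: msuppZ_le.
by rewrite mulr_sumr; apply: eq_bigr => m _; rewrite mcoeffZ mulrA.
Qed.

Lemma ipDr f g h : ip h (f + g) = ip h f + ip h g.
Proof. by rewrite ip_conj ipDl rmorphD /= -!ip_conj. Qed.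
Lemma ipZr c f g : ip f (c *: g) = Num.conj c * ip f g.
Proof. by rewrite ip_conj ipZl rmorphM /= -ip_conj. Qed.
Lemma ipNl f g : ip (- f) g = - ip f g.
Proof. by rewrite -scaleN1r ipZl mulN1r. Qed.
Lemma ipNr f g : ip f (- g) = - ip f g.
Proof. by rewrite -scaleN1r ipZr rmorphN1 mulN1r. Qed.
Lemma ipBl f g h : ip (f - g) h = ip f h - ip g h.
Proof. by rewrite ipDl ipNl. Qed.
Lemma ipBr f g h : ip h (f - g) = ip h f - ip h g.
Proof. by rewrite ipDr ipNr. Qed.
Lemma ip0l f : ip 0 f = 0.
Proof. by rewrite -(scale0r f) ipZl mul0r. Qed.
Lemma ip0r f : ip f 0 = 0.
Proof. by rewrite ip_conj ip0l rmorph0. Qed.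

Lemma ip_suml (I : Type) (s : seq I) (P : pred I) (F : I -> E) g :
  ip (\sum_(i <- s | P i) F i) g = \sum_(i <- s | P i) ip (F i) g.
Proof. exact: (big_morph (ip^~ g) (fun f h => ipDl f h g) (ip0l g)). Qed.

Lemma ipX m g : ip 'X_[m] g = Num.conj g@_m.
Proof. by rewrite /ip msuppX big_seq1 mcoeffX eqxx mul1r. Qed.

Lemma ipXr m f : ip f 'X_[m] = f@_m.
Proof. by rewrite ip_conj ipX conjCK. Qed.

Lemma ip_self_sum f : ip f f = (\sum_(m <- msupp f) normc f@_m ^+ 2)%:C.
Proof. by rewrite rmorph_sum; apply: eq_bigr => m _; exact: mulc_conj. Qed.

Lemma hn_ge0 f : 0 <= hn f. Proof. exact: sqrtr_ge0. Qed.

Lemma hn_sqr f : hn f ^+ 2 = complex.Re (ip f f).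
Proof.
rewrite sqr_sqrtr // ip_self_sum Re_real sumr_ge0 // => m _.
by rewrite exprn_ge0 // normc_ge0.
Qed.

Lemma ip_self f : ip f f = (hn f ^+ 2)%:C.
Proof. by rewrite hn_sqr ip_self_sum. Qed.

Lemma hn_sqr_sum f : hn f ^+ 2 = \sum_(m <- msupp f) normc f@_m ^+ 2.
Proof. by rewrite hn_sqr ip_self_sum. Qed.

Lemma hn_eq0 f : hn f = 0 -> f = 0.
Proof.
move=> f0; apply/mpolyP => m; rewrite mcoeff0.
have := hn_sqr_sum f; rewrite f0 expr0n /=; move/esym/eqP.
rewrite psumr_eq0 => [/allP H|i _]; last by rewrite exprn_ge0 // normc_ge0.
have [/H|/memN_msupp_eq0 //] := boolP (m \in msupp f).
by rewrite /= sqrf_eq0 normc_eq0 => /eqP.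
Qed.

Lemma hn_sqrD f g :
  hn (f + g) ^+ 2 = hn f ^+ 2 + 2 * complex.Re (ip f g) + hn g ^+ 2.
Proof.
rewrite !hn_sqr ipDl !ipDr !ReD [ip g f]ip_conj Re_conj; ring.
Qed.

Lemma hnZ c f : hn (c *: f) = normc c * hn f.
Proof.
apply/eqP; rewrite -(@eqrXn2 _ 2) ?mulr_ge0 ?hn_ge0 ?normc_ge0 //.
by rewrite exprMn !hn_sqr ipZl ipZr mulrA mulc_conj ReZ.
Qed.

Lemma hnN f : hn (- f) = hn f.
Proof. by rewrite -scaleN1r hnZ normcN normc1 mul1r. Qed.

Lemma hn0 : hn 0 = 0.
Proof. by rewrite -(scale0r (0 : E)) hnZ normc0 mul0r. Qed.

Lemma hn_sqrB f g :
  hn (f - g) ^+ 2 = hn f ^+ 2 - 2 * complex.Re (ip f g) + hn g ^+ 2.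
Proof. by rewrite hn_sqrD ipNr ReN hnN mulrN. Qed.

Lemma hn_distC f g : hn (f - g) = hn (g - f).
Proof. by rewrite -hnN opprB. Qed.

(** Optimisation over scalar multiples of f: at t conj(l f) f the left side is 2 t |l f|^2, while
    the norm term is quadratic in t. This turns variational estimates into bounds on functionals. *)
Lemma lin_bound (W : E -> Prop) (l : E -> C) (r : R) : 0 <= r ->
  (forall c f, W f -> W (c *: f)) -> (forall c f, l (c *: f) = c * l f) ->
  (forall f, W f -> 2 * complex.Re (l f) <= r ^+ 2 + hn f ^+ 2) ->
  forall f, W f -> normc (l f) <= r * hn f.
Proof.
move=> r0 WZ lZ H f Wf; apply: quad_bound => //; rewrite ?hn_ge0 ?normc_ge0 //.
  by move/hn_eq0 => ->; rewrite -(scale0r (0 : E)) lZ mul0r normc0.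
move=> t; have := H _ (WZ (t%:C * Num.conj (l f)) _ Wf).
rewrite lZ -mulrA ReZ [_ * l f]mulrC mulc_conj Re_real hnZ normcM normc_conj.
by rewrite normc_real !exprMn real_normK ?num_real // mulrA.
Qed.

Lemma ip_CS f g : normc (ip f g) <= hn f * hn g.
Proof.
rewrite mulrC; apply: (@lin_bound (fun _ => True) (ip^~ g)) => //.
- exact: hn_ge0.
- by move=> c h; exact: ipZl.
by move=> h _; have := sqr_ge0 (hn (h - g)); rewrite hn_sqrB; lra.
Qed.

Lemma Re_ip_CS f g : complex.Re (ip f g) <= hn f * hn g.
Proof. exact: le_trans (Re_le_normc _) (ip_CS _ _). Qed.

Lemma hnD_le f g : hn (f + g) <= hn f + hn g.
Proof.
rewrite -ler_sqr ?nnegrE ?addr_ge0 ?hn_ge0 // hn_sqrD.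
have := Re_ip_CS f g; nra.
Qed.

Lemma hn_sum_le (I : Type) (s : seq I) (P : pred I) (F : I -> E) :
  hn (\sum_(i <- s | P i) F i) <= \sum_(i <- s | P i) hn (F i).
Proof.
elim/big_rec2: _ => [|i x f _ H]; first by rewrite hn0.
by apply: le_trans (hnD_le _ _) _; rewrite lerD2l.
Qed.

(** The adjoint of multiplication by z^a, that is, the projection to H^2 of z^(-a) g. The filter
    discards the terms with negative exponents, which truncated subtraction of multi-indices would
    misplace. *)
Definition bshift a g : E :=
  \sum_(m <- msupp g | (a <= m)%MM) g@_m *: 'X_[m - a].

Lemma mcoeff_bshift a g m : (bshift a g)@_m = g@_(m + a).
Proof.
rewrite /bshift raddf_sum /=.
under eq_bigr do rewrite mcoeffZ mcoeffX.
have H m' : (a <= m')%MM -> (m' - a == m)%MM = (m' == m + a)%MM.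
  by move=> le; rewrite -(eqm_add2r a) submK.
have [inm|/[dup] nm /memN_msupp_eq0 ->] := boolP ((m + a)%MM \in msupp g).
  rewrite big_mkcond (bigD1_seq (m + a)%MM) ?msupp_uniq //=.
  rewrite lem_addl addmK eqxx mulr1 big1 ?addr0 // => m' ne.
  by case: ifP => // le; rewrite H // (negbTE ne) mulr0.
rewrite big_seq_cond big1 // => m' /andP[mg le]; rewrite H //.
by case: eqP => [e|_]; rewrite ?mulr0 //; rewrite e (negbTE nm) in mg.
Qed.

Lemma mcoeffXM a f m :
  ('X_[a] * f)@_m = if (a <= m)%MM then f@_(m - a) else 0.
Proof.
case: ifP => [le|nle].
  by rewrite -commr_mpolyX -{1}(submK le) addmC mcoeffMX.
apply/eqP; rewrite -commr_mpolyX mcoeff_eq0; apply/negP.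
rewrite (perm_mem (msuppMX _ _)) => /mapP[m' _ e]; move: nle.
by rewrite e lem_addr.
Qed.

Lemma bshiftD a f g : bshift a (f + g) = bshift a f + bshift a g.
Proof. by apply/mpolyP => m; rewrite mcoeffD !mcoeff_bshift mcoeffD. Qed.
Lemma bshiftZ a c f : bshift a (c *: f) = c *: bshift a f.
Proof. by apply/mpolyP => m; rewrite mcoeffZ !mcoeff_bshift mcoeffZ. Qed.
Lemma bshiftB a f g : bshift a (f - g) = bshift a f - bshift a g.
Proof. by rewrite -scaleN1r bshiftD bshiftZ scaleN1r. Qed.
Lemma bshiftDm a b f : bshift a (bshift b f) = bshift (a + b) f.
Proof. by apply/mpolyP => m; rewrite !mcoeff_bshift addmA. Qed.
Lemma bshift0 f : bshift 0%MM f = f.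
Proof. by apply/mpolyP => m; rewrite mcoeff_bshift addm0. Qed.
Lemma bshiftXK a f : bshift a ('X_[a] * f) = f.
Proof. by apply/mpolyP => m; rewrite mcoeff_bshift mcoeffXM lem_addl addmK. Qed.

(** This commutation makes [shift_space] invariant under z_j for j outside S. *)
Lemma bshiftXC a b f : (forall i, a i = 0%N \/ b i = 0%N) ->
  bshift a ('X_[b] * f) = 'X_[b] * bshift a f.
Proof.
move=> ab; apply/mpolyP => m; rewrite mcoeff_bshift !mcoeffXM mcoeff_bshift.
have -> : (b <= m + a)%MM = (b <= m)%MM.
  apply/mnm_lepP/mnm_lepP => H i; move: (H i); rewrite mnmDE.
    by case: (ab i) => ->; rewrite ?addn0.
  by move=> Hi; apply: leq_trans Hi (leq_addr _ _).
case: ifP => // /mnm_lepP le; congr (_ @_ _); apply/mnmP => i.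
by rewrite !(mnmDE, mnmBE) addnBAC.
Qed.

Lemma ip_bshift a f g : ip ('X_[a] * f) g = ip f (bshift a g).
Proof.
rewrite {1}[f]mpolyE mulr_sumr ip_suml [RHS]/ip.
apply: eq_bigr => m _; rewrite -scalerAr ipZl -mpolyXD ipX.
by rewrite mcoeff_bshift addmC.
Qed.

Lemma hn_mulX a f : hn ('X_[a] * f) = hn f.
Proof. by rewrite /hn ip_bshift bshiftXK. Qed.

End Hardy.

(** * A lower bound for polynomials on the closed polydisk *)

Section LowerBound.
Import numFieldNormedType.Exports.
Variables (R : realType) (d : nat).
Local Notation V := 'rV[R]_(d + d).

Lemma continuous_add (f g : V -> R) : continuous f -> continuous g ->
  continuous (fun x => f x + g x).
Proof.
by move=> cf cg x; exact: (@continuousD R R^o V f g x (cf x) (cg x)).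
Qed.

Lemma continuous_mul (f g : V -> R) : continuous f -> continuous g ->
  continuous (fun x => f x * g x).
Proof. by move=> cf cg x; exact: (@continuousM R V f g x (cf x) (cg x)). Qed.

Lemma continuous_opp (f : V -> R) : continuous f -> continuous (fun x => - f x).
Proof. by move=> cf x; exact: (@continuousN R R^o V f x (cf x)). Qed.

Definition complex_continuous (F : V -> R[i]) : Prop :=
  continuous (fun x => complex.Re (F x)) /\
  continuous (fun x => complex.Im (F x)).

Lemma complex_continuous_cst c : complex_continuous (fun=> c).
Proof. by split=> x; exact: cst_continuous. Qed.

Lemma complex_continuousD F G : complex_continuous F -> complex_continuous G ->
  complex_continuous (fun x => F x + G x).
Proof.
move=> [F1 F2] [G1 G2]; split.
- have -> : (fun x => complex.Re (F x + G x)) =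
    (fun x => complex.Re (F x) + complex.Re (G x)).
    by apply/funext => x; case: (F x); case: (G x).
  exact: continuous_add.
have -> : (fun x => complex.Im (F x + G x)) =
  (fun x => complex.Im (F x) + complex.Im (G x)).
  by apply/funext => x; case: (F x); case: (G x).
exact: continuous_add.
Qed.

Lemma complex_continuousM F G : complex_continuous F -> complex_continuous G ->
  complex_continuous (fun x => F x * G x).
Proof.
move=> [F1 F2] [G1 G2]; split.
- have -> : (fun x => complex.Re (F x * G x)) = (fun x =>
    complex.Re (F x) * complex.Re (G x) +
    - (complex.Im (F x) * complex.Im (G x))).
    by apply/funext => x; case: (F x); case: (G x).
  by apply: continuous_add; last apply: continuous_opp; exact: continuous_mul.
have -> : (fun x => complex.Im (F x * G x)) = (fun x =>
  complex.Re (F x) * complex.Im (G x) + complex.Im (F x) * complex.Re (G x)).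
  by apply/funext => x; case: (F x); case: (G x).
by apply: continuous_add; exact: continuous_mul.
Qed.

Definition complex_row (x : V) (j : 'I_d) : R[i] :=
  Complex (x ord0 (lshift d j)) (x ord0 (rshift d j)).

Lemma complex_continuous_row j : complex_continuous (complex_row^~ j).
Proof. by split=> x; exact: coord_continuous. Qed.

Lemma complex_continuous_meval (p : {mpoly R[i][d]}) :
  complex_continuous (fun x => p.@[complex_row x]).
Proof.
have -> : (fun x => p.@[complex_row x]) = (fun x =>
    \sum_(m <- msupp p) p@_m * \prod_(j < d) complex_row x j ^+ m j).
  by apply/funext => x; rewrite mevalE.
elim: (msupp p) => [|m s IH].
  under [X in complex_continuous X]funext do rewrite big_nil.
  exact: complex_continuous_cst.
under [X in complex_continuous X]funext do rewrite big_cons.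
apply: complex_continuousD => //; apply: complex_continuousM.
  exact: complex_continuous_cst.
elim: (index_enum _) => [|j r IHr].
  under [X in complex_continuous X]funext do rewrite big_nil.
  exact: complex_continuous_cst.
under [X in complex_continuous X]funext do rewrite big_cons.
apply: complex_continuousM => //; elim: (m j) => [|k IHk].
  under [X in complex_continuous X]funext do rewrite expr0.
  exact: complex_continuous_cst.
under [X in complex_continuous X]funext do rewrite exprS.
by apply: complex_continuousM => //; exact: complex_continuous_row.
Qed.

Definition closed_polydisk : set V :=
  mkset (fun x => forall j, `|complex_row x j| <= 1).

Lemma norm_complex_le1 (a b : R) :
  (`|Complex a b| <= 1) = (a ^+ 2 + b ^+ 2 <= 1).
Proof.
have ab : 0 <= a ^+ 2 + b ^+ 2 by rewrite addr_ge0 ?sqr_ge0.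
by rewrite normc_def /= lecR -{1}sqrtr1 ler_sqrt.
Qed.

(** A closed subset of the compact cube [-1, 1]^(2d). *)
Lemma closed_polydisk_compact : compact closed_polydisk.
Proof.
pose I : set R := mkset (fun r => -1 <= r <= 1).
have -> : closed_polydisk =
    setI (mkset (fun v : V => forall i, I (v ord0 i))) closed_polydisk.
  apply/seteqP; split => [x xP|x []//]; split => // i; rewrite /I /=.
  rewrite -ler_norml -(@ler_sqr _ `|_|) ?nnegrE // real_normK ?num_real //.
  rewrite expr1n -(splitK i); case: (split i) => j /=.
    have := xP j; rewrite norm_complex_le1.
    by have := sqr_ge0 (x ord0 (rshift d j)); lra.
  have := xP j; rewrite norm_complex_le1.
  by have := sqr_ge0 (x ord0 (lshift d j)); lra.
apply: compact_closedI.
  apply: (@rV_compact R (d + d) (fun=> I)) => _.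
  have -> : I = mkset (fun r : R => r \in Interval (BLeft (-1)) (BRight 1)).
    by apply/seteqP; split => r; rewrite /I /= in_itv.
  exact: segment_compact.
have -> : closed_polydisk = bigcap setT (fun j : 'I_d => preimage
    (fun x : V => complex.Re (complex_row x j * Num.conj (complex_row x j)))
    (mkset (fun r => r <= 1))).
  apply/seteqP; split => x H j; first move=> _; have := H j;
    rewrite norm_complex_le1 /= /preimage /= mulrN opprK -!expr2 //.
  by apply.
apply: closed_bigI => j _; apply: preimage_closed; last exact: closed_le.
have [H1 H2] := complex_continuous_row j.
suff [H _] : complex_continuous
    (fun x => complex_row x j * Num.conj (complex_row x j)).
  by move=> x _; exact: H.
apply: complex_continuousM => //; split; first exact: H1.
exact: continuous_opp H2.
Qed.

Lemma polydisk_lower_bound (p : {mpoly R[i][d]}) :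
  (forall z : 'I_d -> R[i], (forall j, `|z j| <= 1) -> p.@[z] != 0) ->
  exists2 c : R, 0 < c & forall z : 'I_d -> R[i],
    (forall j, `|z j| <= 1) -> c <= normc p.@[z].
Proof.
move=> p0.
(* |p|^2 is minimised instead of |p|, being polynomial in the continuous functions Re p and Im p. *)
have [||y yA ymin] := @EVT_min_rV R (d + d)
    (fun x : V =>
       complex.Re p.@[complex_row x] * complex.Re p.@[complex_row x] +
       complex.Im p.@[complex_row x] * complex.Im p.@[complex_row x])
    closed_polydisk _ closed_polydisk_compact.
- by exists 0 => j; rewrite norm_complex_le1 !mxE expr0n addr0.
- apply: continuous_subspaceT; have [H1 H2] := complex_continuous_meval p.
  by apply: continuous_add; exact: continuous_mul.
pose t (z : 'I_d -> R[i]) : V := \row_i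
  match split i with inl j => complex.Re (z j) | inr j => complex.Im (z j) end.
have rowK z : complex_row (t z) =1 z.
  move=> j; rewrite /complex_row !mxE.
  have -> : split (lshift d j) = inl j by exact: (unsplitK (inl j)).
  have -> : split (rshift d j) = inr j by exact: (unsplitK (inr j)).
  by case: (z j).
have normcE2 w : normc w ^+ 2 =
    complex.Re w * complex.Re w + complex.Im w * complex.Im w :> R.
  by case: w => a b /=; rewrite sqr_sqrtr ?addr_ge0 ?sqr_ge0 // !expr2.
exists (normc p.@[complex_row y]).
  rewrite lt_def normc_ge0 normc_eq0 andbT; apply: p0.
  by move: yA; rewrite inE.
move=> z z1; rewrite -ler_sqr ?nnegrE ?normc_ge0 // !normcE2.
have -> : p.@[z] = p.@[complex_row (t z)].
  by apply: meval_eq => j; rewrite rowK.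
by apply: ymin; rewrite inE => j; rewrite rowK.
Qed.
End LowerBound.

(** * Roots of unity and geometric sums *)

Section RootsOfUnity.
Variables (R : realType) (d : nat).
Local Notation C := R[i].
Local Notation E := {mpoly C[d]}.
Implicit Types (f g h : E) (m : 'X_{1..d}).

Lemma prim_root_exists N : (0 < N)%N -> exists z : C, N.-primitive_root z.
Proof.
move=> N0; pose q : {poly C} := 'X^N - 1.
have [rs qE] := closed_field_poly_normal q.
have lq : lead_coef q = 1 by apply/eqP; rewrite -monicE /q -polyC1 monicXnsubC.
rewrite lq scale1r /= in qE.
have /hasP[z _ zP] : has N.-primitive_root rs.
  apply: has_prim_root => //.
  - apply/allP => z; rewrite -root_prod_XsubC -qE /root /q.
    by rewrite unity_rootE !hornerE subr_eq0.
  - rewrite -separable_prod_XsubC -qE separable_Xn_sub_1 //.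
    by rewrite pnatr_eq0 -lt0n.
  by rewrite -ltnS -(size_prod_XsubC _ id) -qE /q -polyC1 size_XnsubC.
by exists z.
Qed.

Definition mono (z : 'I_d -> C) m : C := \prod_j z j ^+ m j.

Lemma meval_sum f (z : 'I_d -> C) :
  f.@[z] = \sum_(m <- msupp f) f@_m * mono z m.
Proof. exact: mevalE. Qed.

Section Prim.
Variables (N : nat) (N_gt0 : (0 < N)%N) (zeta : C).
Hypothesis zetaP : N.-primitive_root zeta.

Lemma prim_root_norm : `|zeta| = 1.
Proof.
apply/eqP; rewrite -(@pexpr_eq1 _ _ N) //.
by rewrite -normrX (prim_expr_order zetaP) normr1.
Qed.

Lemma prim_root_sum a b :
  \sum_(k < N) (zeta ^+ k) ^+ a * Num.conj ((zeta ^+ k) ^+ b) =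
  if a == b %[mod N] then N%:R else 0.
Proof.
pose w := zeta ^+ a * Num.conj (zeta ^+ b).
have -> : \sum_(k < N) (zeta ^+ k) ^+ a * Num.conj ((zeta ^+ k) ^+ b) =
  \sum_(k < N) w ^+ k.
  apply: eq_bigr => k _; rewrite exprMn -!exprM -rmorphXn /= -!exprM.
  by rewrite ![(k * _)%N]mulnC.
have zb : zeta ^+ b * Num.conj (zeta ^+ b) = 1.
  by rewrite rmorphXn /= -exprMn -normCK prim_root_norm !expr1n.
have w1 : (w == 1) = (a == b %[mod N]).
  rewrite -(eq_prim_root_expr zetaP); apply/eqP/eqP => [|e]; last first.
    by rewrite /w e zb.
  move/(congr1 (fun x => x * zeta ^+ b)).
  rewrite /w -mulrA [_ * zeta ^+ b]mulrC.
  by rewrite zb mulr1 mul1r.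
rewrite -w1; case: eqVneq => [->|wn1].
  under eq_bigr do rewrite expr1n.
  by rewrite sumr_const card_ord.
apply: (@mulfI _ (w - 1)); first by rewrite subr_eq0.
rewrite mulr0 -subrX1 /w exprMn -rmorphXn /= -!exprM ![(_ * N)%N]mulnC !exprM.
by rewrite (prim_expr_order zetaP) !expr1n rmorph1 mulr1 subrr.
Qed.

Definition torus_pt (r : R) (k : {ffun 'I_d -> 'I_N}) (j : 'I_d) : C :=
  r%:C * zeta ^+ k j.

Lemma norm_torus_pt k j : `|torus_pt 1 k j| = 1.
Proof. by rewrite /torus_pt mul1r normrX prim_root_norm expr1n. Qed.

Lemma mono_torus_pt r k m :
  mono (torus_pt r k) m = (r ^+ mdeg m)%:C * mono (torus_pt 1 k) m.
Proof.
rewrite /mono mdegE rmorphXn -prodrXr -big_split /=; apply: eq_bigr => j _.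
by rewrite /torus_pt mul1r exprMn.
Qed.

Lemma mono_sum m m' :
  \sum_k mono (torus_pt 1 k) m * Num.conj (mono (torus_pt 1 k) m') =
  if [forall j, m j == m' j %[mod N]] then (N ^ d)%:R else 0.
Proof.
under eq_bigr do rewrite rmorph_prod -big_split /=.
under eq_bigr do under eq_bigr do rewrite /torus_pt !mul1r.
rewrite -(bigA_distr_bigA (fun j (k : 'I_N) =>
  (zeta ^+ k) ^+ m j * Num.conj ((zeta ^+ k) ^+ m' j))) /=.
under eq_bigr do rewrite prim_root_sum.
case: forallP => [H|/forallP/forallPn[j nj]].
  under eq_bigr => j _ do rewrite (H j).
  by rewrite prodr_const card_ord natrX.
by rewrite (bigD1 j) //= (negbTE nj) mul0r.
Qed.

Lemma mod_mdeg_lt m m' : (mdeg m < N)%N -> (mdeg m' < N)%N ->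
  [forall j, m j == m' j %[mod N]] = (m == m').
Proof.
have le (n : 'X_{1..d}) j : (n j <= mdeg n)%N.
  by rewrite mdegE (bigD1 j) //= leq_addr.
move=> mN m'N; apply/forallP/eqP => [H|->//]; apply/mnmP => j.
by have := H j; rewrite !modn_small ?(leq_ltn_trans (le _ _)) // => /eqP.
Qed.

(** The average over N^d torus points replaces the integral over the torus. It is exact because in
    degrees below N distinct exponents are never congruent mod N. *)
Lemma parseval f g : (msize f <= N)%N -> (msize g <= N)%N ->
  \sum_k f.@[torus_pt 1 k] * Num.conj g.@[torus_pt 1 k] = (N ^ d)%:R * ip f g.
Proof.
move=> fN gN.
under eq_bigr do rewrite !meval_sum rmorph_sum /= mulr_suml.
rewrite exchange_big /= /ip mulr_sumr big_seq [RHS]big_seq.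
apply: eq_bigr => m mf.
under eq_bigr do rewrite mulr_sumr.
rewrite exchange_big /=.
have mN := leq_trans (msize_mdeg_lt mf) fN.
rewrite (eq_bigr (fun m' => if m == m'
    then (N ^ d)%:R * (f@_m * Num.conj g@_m) else 0)) => [|m' _]; last first.
  have [m'g|/memN_msupp_eq0 g0] := boolP (m' \in msupp g); last first.
    rewrite big1 => [|k _]; last by rewrite g0 mul0r rmorph0 mulr0.
    by case: eqVneq => [->|//]; rewrite g0 rmorph0 !mulr0.
  under eq_bigr => k _ do rewrite rmorphM /= mulrACA.
  rewrite -mulr_sumr mono_sum mod_mdeg_lt ?(leq_trans (msize_mdeg_lt m'g)) //.
  by case: eqVneq => [->|_]; rewrite ?mulr0 // mulrC.
have [mg|/memN_msupp_eq0 g0] := boolP (m \in msupp g).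
  rewrite (bigD1_seq m) ?msupp_uniq //= eqxx big1 ?addr0 // => m' ne.
  by rewrite eq_sym (negbTE ne).
by rewrite g0 rmorph0 !mulr0 big1 // => m' _; case: ifP.
Qed.
End Prim.

(** The inner product depends only on boundary values. The equality |p~| = |p| on the torus enters
    the proof through this lemma. *)
Lemma ip_eq_torus f1 g1 f2 g2 :
  (forall z : 'I_d -> C, (forall j, `|z j| = 1) ->
    f1.@[z] * Num.conj g1.@[z] = f2.@[z] * Num.conj g2.@[z]) ->
  ip f1 g1 = ip f2 g2.
Proof.
move=> H; pose N := (msize f1 + msize g1 + msize f2 + msize g2).+1.
have [z zP] := @prim_root_exists N isT.
have Nd : ((N ^ d)%:R : C) != 0 by rewrite pnatr_eq0 -lt0n expn_gt0.
apply: (mulfI Nd); rewrite -!(parseval _ zP) //; try (rewrite /N; lia).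
apply: eq_bigr => k _; apply: H => j.
exact: (norm_torus_pt _ zP).
Qed.

Lemma hn_le_torus f g (c : R) : 0 <= c ->
  (forall z : 'I_d -> C, (forall j, `|z j| = 1) ->
     c * normc f.@[z] <= normc g.@[z]) -> c * hn f <= hn g.
Proof.
move=> c0 H; pose N := (msize f + msize g).+1.
have [z zP] := @prim_root_exists N isT.
have Nd : 0 < ((N ^ d)%:R : R) by rewrite ltr0n expn_gt0.
have P h : (msize h <= N)%N -> (N ^ d)%:R * hn h ^+ 2 =
   \sum_(k : {ffun 'I_d -> 'I_N}) normc h.@[torus_pt z 1 k] ^+ 2.
  move=> hN; apply: complexI; rewrite rmorphM /= -ip_self rmorph_nat.
  rewrite -(parseval _ zP) // rmorph_sum; apply: eq_bigr => k _.
  exact: mulc_conj.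
rewrite -ler_sqr ?nnegrE ?mulr_ge0 ?hn_ge0 // exprMn.
rewrite -(ler_pM2l Nd) mulrCA !P ?mulr_sumr; try (rewrite /N; lia).
apply: ler_sum => k _; rewrite -exprMn ler_sqr ?nnegrE ?mulr_ge0 ?normc_ge0 //.
by apply: H => j; exact: (norm_torus_pt _ zP).
Qed.
End RootsOfUnity.

Section Geometric.
Variables (R : realType) (d : nat).

Lemma ler_sum_subset (T : eqType) (s t : seq T) (F : T -> R) :
  uniq s -> uniq t -> {subset s <= t} -> (forall x, 0 <= F x) ->
  \sum_(x <- s) F x <= \sum_(x <- t) F x.
Proof.
move=> us ut st F0; rewrite [leRHS](bigID (mem s)) /= -[leLHS]addr0 lerD //.
  rewrite -[leRHS]big_filter le_eqVlt; apply/orP; left; apply/eqP.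
  apply: perm_big; apply: uniq_perm; rewrite ?filter_uniq // => x.
  by rewrite mem_filter; case: (boolP (x \in s)) => //= /st ->.
by apply: sumr_ge0.
Qed.

Definition box_mnm N (k : {ffun 'I_d -> 'I_N}) : 'X_{1..d} :=
  [multinom (k j : nat) | j < d].

Lemma box_mnm_inj N : injective (@box_mnm N).
Proof.
move=> k l /mnmP H; apply/ffunP => j; apply/val_inj.
by have := H j; rewrite !mnmE.
Qed.

Lemma box_mnmP N (m : 'X_{1..d}) :
  (mdeg m < N)%N -> m \in [seq box_mnm k | k : {ffun 'I_d -> 'I_N}].
Proof.
move=> mN.
have H j : (m j < N)%N.
  by apply: leq_ltn_trans mN; rewrite mdegE (bigD1 j) //= leq_addr.
apply/mapP; exists [ffun j => Ordinal (H j)]; first by rewrite mem_enum.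
by apply/mnmP => j; rewrite mnmE ffunE.
Qed.

Lemma geometric_le (rho : R) n : 0 <= rho -> rho < 1 ->
  \sum_(k < n) rho ^+ k <= (1 - rho)^-1.
Proof.
move=> r0 r1; have p : 0 < 1 - rho by rewrite subr_gt0.
rewrite -[leRHS]mul1r ler_pdivlMr // mulrC -opprB mulNr -subrX1 opprB.
by rewrite gerBl exprn_ge0.
Qed.

(** A finite set of multi-indices lies in a box, and over a box the sum factors into d geometric
    sums. *)
Lemma geometric_mnm_le (s : seq 'X_{1..d}) (rho : R) : 0 <= rho -> rho < 1 ->
  uniq s -> \sum_(m <- s) rho ^+ mdeg m <= (1 - rho) ^- d.
Proof.
move=> r0 r1 us; pose N := (\sum_(m <- s) mdeg m).+1.
have sN m : m \in s -> (mdeg m < N)%N.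
  by move=> ms; rewrite ltnS (bigD1_seq m) //= leq_addr.
apply: (@le_trans _ _ (\sum_(m <- [seq box_mnm k | k : {ffun 'I_d -> 'I_N}])
    rho ^+ mdeg m)).
  apply: ler_sum_subset => // [|m /sN|m]; last exact: exprn_ge0.
    by rewrite map_inj_uniq ?enum_uniq //; exact: box_mnm_inj.
  exact: box_mnmP.
rewrite big_map big_enum /=.
have -> : \sum_(k : {ffun 'I_d -> 'I_N}) rho ^+ mdeg (box_mnm k) =
   \prod_(j < d) \sum_(k < N) rho ^+ k.
  rewrite bigA_distr_bigA; apply: eq_bigr => k _.
  rewrite mdegE -prodrXr; apply: eq_bigr => j _; by rewrite mnmE.
rewrite -exprVn -[X in _ ^+ X]card_ord -prodr_const.
apply: ler_prod => j _; rewrite geometric_le // andbT.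
by apply: sumr_ge0 => k _; exact: exprn_ge0.
Qed.
End Geometric.

(** * Density of the multiples of an outer polynomial *)

Section Density.
Variables (R : realType) (d : nat).
Local Notation C := R[i].
Local Notation E := {mpoly C[d]}.
Implicit Types (p q f g h : E) (r s : R).

Definition dense_range p : Prop :=
  forall f (e : R), 0 < e -> exists h, hn (p * h - f) <= e.

Definition dilate r p : E :=
  \sum_(m <- msupp p) (p@_m * (r ^+ mdeg m)%:C) *: 'X_[m].

Lemma meval_dilate r p (z : 'I_d -> C) :
  (dilate r p).@[z] = p.@[fun j => r%:C * z j].
Proof.
rewrite /dilate raddf_sum /= [RHS]mevalE; apply: eq_bigr => m _.
rewrite mevalZ mevalX -mulrA; congr (_ * _).
rewrite mdegE rmorphXn /= -prodrXr -big_split /=; apply: eq_bigr => j _.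
by rewrite exprMn.
Qed.

Lemma dilate1 p : dilate 1 p = p.
Proof.
rewrite [RHS]mpolyE; apply: eq_bigr => m _.
by rewrite expr1n mulr1.
Qed.

Lemma dilate0 p : dilate 0 p = (p.@[fun=> 0])%:MP.
Proof.
apply/mpolyP => m; rewrite mcoeffC /dilate raddf_sum mevalE mulr_suml /=.
apply: eq_bigr => m' _; rewrite mcoeffZ mcoeffX -!mulrA; congr (_ * _).
have [->|nz] := eqVneq m' 0%MM.
  rewrite mdeg0 expr0 rmorph1 [m == _]eq_sym big1 // => i _.
  by rewrite mnm0E expr0.
have /forallPn[j mj] : ~~ [forall j, m' j == 0%N].
  apply: contra nz => /forallP H; apply/eqP/mnmP => j.
  by rewrite mnm0E; apply/eqP.
rewrite (bigD1 j) //= [0 ^+ m' j]expr0n (negbTE mj) !mul0r.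
by rewrite expr0n mdeg_eq0 (negbTE nz) rmorph0 mul0r.
Qed.

Lemma exprn_lipschitz r s n : 0 <= r <= 1 -> 0 <= s <= 1 ->
  `|r ^+ n - s ^+ n| <= n%:R * `|r - s|.
Proof.
move=> /andP[r0 r1] /andP[s0 s1]; elim: n => [|n IH].
  by rewrite !expr0 subrr normr0 mul0r.
have -> : r ^+ n.+1 - s ^+ n.+1 = r * (r ^+ n - s ^+ n) + (r - s) * s ^+ n.
  rewrite !exprS; ring.
apply: le_trans (ler_normD _ _) _.
rewrite -natr1 [_ * `|_|]mulrDl mul1r lerD //.
  by rewrite normrM ger0_norm // (le_trans _ IH) // ler_piMl.
by rewrite normrM ler_piMr // ger0_norm ?exprn_ge0 // exprn_ile1.
Qed.

(** Multiplication by a monomial is isometric, so multiplication by a polynomial has norm at most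
    the sum of the moduli of its coefficients. *)
Lemma hn_dilateB p r s h : 0 <= r <= 1 -> 0 <= s <= 1 ->
  hn ((dilate r p - dilate s p) * h) <=
  `|r - s| * (\sum_(m <- msupp p) normc p@_m * (mdeg m)%:R) * hn h.
Proof.
move=> r01 s01.
have -> : dilate r p - dilate s p =
    \sum_(m <- msupp p) (p@_m * (r ^+ mdeg m - s ^+ mdeg m)%:C) *: 'X_[m].
  rewrite -sumrB; apply: eq_bigr => m _.
  by rewrite -scalerBl -mulrBr rmorphB.
rewrite mulr_suml; apply: le_trans (hn_sum_le _ _ _) _.
rewrite mulr_sumr mulr_suml; apply: ler_sum => m _.
rewrite -scalerAl hnZ hn_mulX normcM normc_real.
rewrite ler_wpM2r ?hn_ge0 // mulrCA ler_wpM2l ?normc_ge0 //.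
by rewrite mulrC exprn_lipschitz.
Qed.

Lemma ler_half_step (c x y t u b : R) : 0 <= b -> c * x <= y -> y <= t + b ->
  t <= b / 8 -> u <= c / 4 * x -> t + u <= b / 2.
Proof. lra. Qed.

(** As in a Neumann series, an approximate solution for p leaves a residual of at most half the norm
    for q, and the residual is treated in the same way. *)
Lemma dense_range_perturb p q (c : R) : 0 < c -> dense_range p ->
  (forall h, c * hn h <= hn (p * h)) ->
  (forall h, hn ((q - p) * h) <= c / 4 * hn h) -> dense_range q.
Proof.
move=> c0 dp low small.
(* With |p h - f| <= |f| / 8 one has c |h| <= 9/8 |f|, so the perturbation costs at most 9/32 |f|,
   and 1/8 + 9/32 < 1/2. *)
have half f : exists h, hn (q * h - f) <= hn f / 2.
  have [f0|f0] := eqVneq (hn f) 0.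
    by exists 0; rewrite mulr0 sub0r hnN f0 mul0r.
  have fp : 0 < hn f by rewrite lt_def f0 hn_ge0.
  have [|h hP] := dp f (hn f / 8); first by rewrite divr_gt0.
  exists h.
  have -> : q * h - f = (p * h - f) + (q - p) * h by ring.
  apply: le_trans (hnD_le _ _) _.
  have : hn (p * h) <= hn (p * h - f) + hn f.
    by rewrite -{1}[p * h](subrK f) hnD_le.
  move=> ph; exact: (ler_half_step (ltW fp) (low h) ph hP (small h)).
have halves n f : exists h, hn (q * h - f) <= hn f / 2 ^+ n.
  elim: n f => [|n IH] f.
    by exists 0; rewrite mulr0 sub0r hnN expr0 divr1.
  have [h1 H1] := half f; have [h2 H2] := IH (q * h1 - f).
  exists (h1 - h2).
  have -> : q * (h1 - h2) - f = - (q * h2 - (q * h1 - f)) by ring.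
  rewrite hnN; apply: le_trans H2 _.
  by rewrite exprS invfM mulrA ler_wpM2r // invr_ge0 exprn_ge0.
move=> f e e0; have [h H] := halves (Num.truncn (hn f / e)).+1 f.
exists h; apply: le_trans H _.
rewrite ler_pdivrMr ?exprn_gt0 // mulrC -ler_pdivrMr //.
have fe : 0 <= hn f / e by rewrite divr_ge0 ?hn_ge0 // ltW.
have /andP[_ /ltW] := truncn_itv fe.
move/le_trans; apply; rewrite -natrX ler_nat; exact/ltnW/ltn_expl.
Qed.

(* Continuity method: the lower bound c is the same for all dilates, so finitely
   many steps of [dense_range_perturb] lead from the constant p(0) to p. *)
Lemma dense_range_outer p :
  (forall z : 'I_d -> C, (forall j, `|z j| <= 1) -> p.@[z] != 0) ->
  dense_range p.
Proof.
move=> p0; have [c c0 low] := polydisk_lower_bound p0.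
pose L := \sum_(m <- msupp p) normc p@_m * (mdeg m)%:R.
have L0 : 0 <= L by apply: sumr_ge0 => m _; rewrite mulr_ge0 ?normc_ge0.
have low_r r : 0 <= r <= 1 -> forall h, c * hn h <= hn (dilate r p * h).
  move=> /andP[r0 r1] h; apply: hn_le_torus; first exact: ltW.
  move=> z z1; rewrite mevalM normcM ler_wpM2r ?normc_ge0 // meval_dilate.
  apply: low => j; rewrite normrM z1 mulr1 normcR lecR normc_real ger0_norm //.
(* [L] is a Lipschitz constant of the multiplier in r, so M > 4 L / c steps of length 1/M stay
   within the tolerance c / 4. *)
pose M := (Num.truncn (4 * L / c)).+1.
have M0 : 0 < (M%:R : R) by rewrite ltr0n.
have ML : L / M%:R <= c / 4.
  rewrite ler_pdivrMr //.
  have /andP[_ /ltW] : (Num.truncn (4 * L / c))%:R <= 4 * L / c < M%:R.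
    by apply: truncn_itv; rewrite divr_ge0 ?mulr_ge0 // ltW.
  rewrite ler_pdivrMr // => H; nra.
have step k : (k <= M)%N -> dense_range (dilate (k%:R / M%:R) p).
  elim: k => [_|k IH kM].
    rewrite mul0r dilate0; set a := p.@[_].
    have a0 : a != 0 by apply: p0 => j; rewrite normr0 ler01.
    move=> f e e0; exists (a^-1 *: f).
    by rewrite mul_mpolyC scalerA divff // scale1r subrr hn0 ltW.
  have in01 l : (l <= M)%N -> 0 <= (l%:R / M%:R : R) <= 1.
    by move=> lM; rewrite divr_ge0 ?ler0n //= ler_pdivrMr // mul1r ler_nat.
  apply: (dense_range_perturb c0 (IH (ltnW kM))).
    exact/low_r/in01/ltnW.
  move=> h; apply: le_trans (hn_dilateB _ _ (in01 _ kM) (in01 _ (ltnW kM))) _.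
  rewrite ler_wpM2r ?hn_ge0 // -mulrBl -natr1 addrAC subrr add0r mul1r.
  by rewrite ger0_norm ?invr_ge0 ?ler0n // mulrC.
by have := step M (leqnn _); rewrite divff ?dilate1 // gt_eqF.
Qed.
End Density.

(** * Kernels as quadratic forms on finitely supported vectors *)

Section DualVectors.
Variables (R : realType) (d : nat).
Local Notation C := R[i].
Local Notation E := {mpoly C[d]}.
Local Notation X := (polydisk R d).
Local Notation dvec := (seq (C * X)).
Implicit Types (u v w : dvec) (K L : kernel R d) (f g : X -> C).

(** The list stands for a finitely supported vector, here paired with a function. Points may repeat,
    and concatenation is addition. *)
Definition lin v f : C := \sum_(a <- v) Num.conj a.1 * f a.2.

Lemma lin_cat u v f : lin (u ++ v) f = lin u f + lin v f.
Proof. exact: big_cat. Qed.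

Lemma linD v f g : lin v (fun x => f x + g x) = lin v f + lin v g.
Proof. by rewrite /lin -big_split; apply: eq_bigr => a _; rewrite mulrDr. Qed.

Lemma linZ v c f : lin v (fun x => c * f x) = c * lin v f.
Proof. by rewrite /lin mulr_sumr; apply: eq_bigr => a _; rewrite mulrCA. Qed.

Lemma eq_lin v f g : f =1 g -> lin v f = lin v g.
Proof. by move=> fg; apply: eq_bigr => a _; rewrite fg. Qed.

(* Written with [lin] so that it visibly depends on [u] and [v] only through the
   functionals [lin u] and [lin v]. *)
Definition bq K u v : C :=
  lin u (fun z => Num.conj (lin v (fun y => Num.conj (K z y)))).
Definition qf K v : C := bq K v v.

Lemma bqE K u v :
  bq K u v = \sum_(a <- u) \sum_(b <- v) Num.conj a.1 * K a.2 b.2 * b.1.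
Proof.
apply: eq_bigr => a _; rewrite rmorph_sum mulr_sumr; apply: eq_bigr => b _.
by rewrite rmorphM /= !conjCK -mulrA [b.1 * _]mulrC.
Qed.

Lemma qfD K L v : qf (fun z y => K z y + L z y) v = qf K v + qf L v.
Proof.
rewrite /qf !bqE -big_split; apply: eq_bigr => a _.
by rewrite -big_split; apply: eq_bigr => b _; rewrite mulrDr mulrDl.
Qed.

Lemma qfZ c K v : qf (fun z y => c * K z y) v = c * qf K v.
Proof.
rewrite /qf !bqE mulr_sumr; apply: eq_bigr => a _.
by rewrite mulr_sumr; apply: eq_bigr => b _; rewrite !mulrA [_ * c]mulrC.
Qed.

Lemma eq_qf K L v : (forall z y, K z y = L z y) -> qf K v = qf L v.
Proof.
move=> KL; rewrite /qf !bqE; apply: eq_bigr => a _.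
by apply: eq_bigr => b _; rewrite KL.
Qed.

Lemma qfB K L v : qf (fun z y => K z y - L z y) v = qf K v - qf L v.
Proof.
rewrite -[- qf L v]mulN1r -qfZ -qfD.
by apply: eq_qf => z y; rewrite mulN1r.
Qed.

Lemma qf_rank1 f v : qf (rank1 f) v = (normc (lin v f) ^+ 2)%:C.
Proof.
rewrite -mulc_conj /qf /bq /rank1 [RHS]mulrC -linZ; apply: eq_lin => z.
have -> : lin v (fun y => Num.conj (f z * Num.conj (f y))) =
   Num.conj (f z) * lin v f.
  by rewrite -linZ; apply: eq_lin => y; rewrite rmorphM /= conjCK.
by rewrite rmorphM /= conjCK mulrC.
Qed.

(** The adjoint of multiplication by k, as it acts on kernel vectors. *)
Definition mulv (k : X -> C) v : dvec :=
  [seq (Num.conj (k a.2) * a.1, a.2) | a <- v].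

Lemma lin_mulv k v f : lin (mulv k v) f = lin v (fun x => k x * f x).
Proof.
rewrite /lin big_map; apply: eq_bigr => a _ /=.
by rewrite rmorphM /= conjCK mulrA [k _ * _]mulrC.
Qed.

Lemma qf_mulv k K v :
  qf K (mulv k v) = qf (fun z y => k z * K z y * Num.conj (k y)) v.
Proof.
rewrite /qf !bqE big_map; apply: eq_bigr => a _.
rewrite big_map; apply: eq_bigr => b _ /=; rewrite rmorphM /= conjCK; ring.
Qed.

Definition pos_kernel K : Prop := forall v, 0 <= qf K v.

Lemma sum_merge (T : eqType) (f : T -> C) (v : seq (C * T)) (s : seq T) :
  uniq s -> {subset [seq a.2 | a <- v] <= s} ->
  \sum_(a <- v) Num.conj a.1 * f a.2 =
  \sum_(x <- s) Num.conj (\sum_(a <- v | a.2 == x) a.1) * f x.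
Proof.
move=> us sub.
under [RHS]eq_bigr do rewrite rmorph_sum mulr_suml.
rewrite (exchange_big_dep predT) //= big_seq [RHS]big_seq.
apply: eq_bigr => a av; rewrite -big_filter.
have as_ : a.2 \in s by apply: sub; exact: map_f.
have -> : [seq x <- s | a.2 == x] = [:: a.2].
  under eq_filter do rewrite eq_sym.
  exact: filter_pred1_uniq.
by rewrite big_seq1.
Qed.

(** [psd_kernel] asks for distinct points. Since [qf] sees v only through [lin v], the coefficients
    of a repeated point can be added up first. *)
Lemma psd_kernelP K : psd_kernel K <-> pos_kernel K.
Proof.
have quadE m (x : 'I_m -> X) (c : 'cV[C]_m) :
    ((c^t* *m (\matrix_(i < m, j < m) K (x i) (x j)) *m c) 0 0)%sesqui =
    qf K [seq (c i 0, x i) | i <- enum 'I_m].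
  rewrite /qf bqE big_map big_enum mxE /=.
  under [RHS]eq_bigr do rewrite big_map big_enum /=.
  rewrite [RHS]exchange_big; apply: eq_bigr => j _ /=; rewrite mxE mulr_suml.
  by apply: eq_bigr => i _; rewrite !mxE.
split=> [H v|H m x _ c]; last by rewrite quadE.
pose T : eqType := {z : {ffun 'I_d -> C} | [forall j, `|z j| < 1]}.
pose s : seq T := undup [seq (a.2 : T) | a <- v].
have us : uniq s by exact: undup_uniq.
pose x (i : 'I_(size s)) : X := tnth (in_tuple s) i.
have xi : injective x by apply: (tuple_uniqP (in_tuple s) us).
pose c : 'cV[C]_(size s) := \col_i \sum_(a <- v | (a.2 : T) == x i) a.1.
have := H _ x xi c; rewrite quadE.
suff linE f : lin [seq (c i 0, x i) | i <- enum 'I_(size s)] f = lin v f.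
  rewrite /qf /bq linE; congr (0 <= _); apply: eq_lin => z.
  by rewrite linE.
rewrite [RHS](@sum_merge T f v s us) => [|y]; last by rewrite mem_undup.
rewrite /lin big_map big_enum /=.
rewrite [RHS](big_tnth _ _ s) /=; apply: eq_bigr => i _.
by rewrite mxE.
Qed.

Definition rq K v : R := complex.Re (qf K v).

Lemma pos_rq K v : pos_kernel K -> 0 <= rq K v.
Proof. by move=> /(_ v); rewrite ge0cE => /andP[]. Qed.

Lemma pos_qfE K v : pos_kernel K -> qf K v = (rq K v)%:C.
Proof.
move=> /(_ v); rewrite ge0cE /rq => /andP[/eqP I0 _].
by rewrite [LHS]complexE I0 mulr0 addr0.
Qed.

Lemma rqB K L v : rq (fun z y => K z y - L z y) v = rq K v - rq L v.
Proof. by rewrite /rq qfB ReB. Qed.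
Lemma rqD K L v : rq (fun z y => K z y + L z y) v = rq K v + rq L v.
Proof. by rewrite /rq qfD ReD. Qed.

(** The best t is e / a; shifting both by n > 0 covers a = 0, and n is then sent to 0. *)
Lemma quad_bound_sym (a b e : R) : 0 <= a -> 0 <= e ->
  (forall t, t * b <= t ^+ 2 * a ^+ 2 + e ^+ 2) -> b <= 2 * a * e.
Proof.
move=> a0 e0 H; apply: (@ler_addeps _ _ _ (a + e)) => n n0 _.
have an : 0 < a + n by rewrite ltr_wpDl.
have en : 0 < e + n by rewrite ltr_wpDl.
have := H ((e + n) / (a + n)); rewrite mulrAC ler_pdivrMr //.
have -> : (((e + n) / (a + n)) ^+ 2 * a ^+ 2 + e ^+ 2) * (a + n) =
   (e + n) ^+ 2 * a ^+ 2 / (a + n) + e ^+ 2 * (a + n).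
  by field; rewrite gt_eqF.
have an2 : a ^+ 2 <= a * (a + n) by nra.
have en2 : e ^+ 2 <= e * (e + n) by nra.
have : (e + n) ^+ 2 * a ^+ 2 / (a + n) <= (e + n) ^+ 2 * a.
  by rewrite ler_pdivrMr // -[leRHS]mulrA ler_wpM2l ?sqr_ge0.
have : e ^+ 2 * (a + n) <= e * (e + n) * (a + n).
  by nra.
move=> H1 H2 H3; rewrite -(ler_pM2l en); nra.
Qed.

(** The triangle inequality for the seminorm of K. The vectors are related as functionals, whatever
    lists represent them. *)
Lemma sqrt_rqD K u v w : pos_kernel K ->
  (forall f, lin u f = lin v f + lin w f) ->
  Num.sqrt (rq K u) <= Num.sqrt (rq K v) + Num.sqrt (rq K w).
Proof.
move=> pK uvw.
have bqDl u' : bq K u u' = bq K v u' + bq K w u' by rewrite /bq uvw.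
have bqDr u' : bq K u' u = bq K u' v + bq K u' w.
  by rewrite -linD; apply: eq_lin => z; rewrite uvw rmorphD.
have E1 : rq K u =
    rq K v + complex.Re (bq K v w + bq K w v) + rq K w.
  by rewrite /rq /qf bqDl !bqDr !ReD; ring.
have B : complex.Re (bq K v w + bq K w v) <=
   2 * Num.sqrt (rq K v) * Num.sqrt (rq K w).
  apply: quad_bound_sym; rewrite ?sqrtr_ge0 // => t.
  rewrite !sqr_sqrtr ?pos_rq //.
  (* Positivity at t v - w for every real t bounds the cross term. *)
  pose u' := mulv (fun=> t%:C) v ++ mulv (fun=> -1) w.
  have lE f : lin u' f = t%:C * lin v f - lin w f.
    by rewrite lin_cat !lin_mulv !linZ mulN1r.
  have bEl x : bq K u' x = t%:C * bq K v x - bq K w x by rewrite /bq lE.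
  have bE x : bq K x u' = t%:C * bq K x v - bq K x w.
    rewrite -mulN1r -!linZ -linD; apply: eq_lin => z.
    rewrite lE rmorphB rmorphM /= mulN1r; congr (_ * _ - _).
    exact: conjc_real.
  have := pos_rq u' pK; rewrite /rq /qf bEl !bE !mulrBr !ReB !ReZ ReD; lra.
rewrite -ler_sqr ?nnegrE ?addr_ge0 ?sqrtr_ge0 // sqrrD !sqr_sqrtr ?pos_rq //.
by rewrite E1 -mulr_natl mulrA; lra.
Qed.

End DualVectors.

(** * Evaluation functionals *)

Section SmallSequences.
Variable R : realType.
Implicit Types (u v : nat -> R) (c e : R).

Definition vanishing u : Prop :=
  forall e, 0 < e -> exists n0, forall n, (n0 <= n)%N -> u n <= e.

Lemma vanishing_le u v : (forall n, u n <= v n) -> vanishing v -> vanishing u.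
Proof.
by move=> uv sv e /sv[n0 H]; exists n0 => n /H; exact: le_trans.
Qed.

Lemma vanishingD u v :
  vanishing u -> vanishing v -> vanishing (fun n => u n + v n).
Proof.
move=> su sv e e0; have e2 : 0 < e / 2 by rewrite divr_gt0.
have [n1 H1] := su _ e2; have [n2 H2] := sv _ e2.
exists (maxn n1 n2) => n; rewrite geq_max => /andP[/H1 + /H2]; lra.
Qed.

Lemma vanishingZ c u : 0 <= c -> vanishing u -> vanishing (fun n => c * u n).
Proof.
move=> c0 su e e0; have c1 : 0 < c + 1 by rewrite ltr_wpDl.
have [n0 H] := su _ (divr_gt0 e0 c1); exists n0 => n /H.
rewrite ler_pdivlMr // => un; have [u0|/ltW u0] := leP 0 (u n); first nra.
by apply: (le_trans _ (ltW e0)); rewrite mulr_ge0_le0.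
Qed.

Lemma vanishing0 : vanishing (fun=> 0).
Proof. by move=> e e0; exists 0%N => n _; exact: ltW. Qed.

Lemma vanishing_sum (I : Type) (s : seq I) (c : I -> R) (u : I -> nat -> R) :
  (forall i, 0 <= c i) -> (forall i, vanishing (u i)) ->
  vanishing (fun n => \sum_(i <- s) c i * u i n).
Proof.
move=> c0 su; elim: s => [|i s IH].
  by apply: vanishing_le vanishing0 => n; rewrite big_nil.
apply: (@vanishing_le _ (fun n => c i * u i n + \sum_(i <- s) c i * u i n)).
  by move=> n; rewrite big_cons.
by apply: vanishingD => //; exact: vanishingZ.
Qed.

(** The powers q^k with k < n are all at least q^n, so n q^n <= 1 / (1 - q). *)
Lemma vanishing_geometric q : 0 <= q -> q < 1 -> vanishing (fun n => q ^+ n).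
Proof.
move=> q0 q1 e e0; have p : 0 < 1 - q by rewrite subr_gt0.
exists (Num.truncn ((1 - q)^-1 / e)).+1 => n nN.
have n0 : 0 < (n%:R : R) by rewrite ltr0n; apply: leq_trans nN.
have H : n%:R * q ^+ n <= (1 - q)^-1.
  apply: le_trans (@geometric_le R q n q0 q1).
  rewrite mulr_natl -[X in _ *+ X]card_ord -sumr_const; apply: ler_sum => k _.
  by apply: ler_wiXn2l => //; [exact: ltW | exact: ltnW].
have : (1 - q)^-1 / e <= n%:R.
  have x0 : 0 <= (1 - q)^-1 / e by rewrite divr_ge0 ?invr_ge0 // ltW.
  have /andP[_ /ltW/le_trans] := truncn_itv x0.
  by apply; rewrite ler_nat.
rewrite ler_pdivrMr // => H2; rewrite -(ler_pM2l n0).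
exact: le_trans H H2.
Qed.

Lemma vanishing_harmonic : vanishing (fun n => n.+1%:R^-1).
Proof.
move=> e e0; exists (Num.truncn e^-1) => n nN.
rewrite -[leRHS]invrK lef_pV2 ?posrE ?invr_gt0 // ?ltr0n //.
have x0 : 0 <= e^-1 by rewrite invr_ge0 ltW.
have /andP[_ /ltW/le_trans] := truncn_itv x0.
by apply; rewrite ler_nat.
Qed.

End SmallSequences.

Section Evaluation.
Variables (R : realType) (d : nat).
Local Notation C := R[i].
Local Notation E := {mpoly C[d]}.
Local Notation X := (polydisk R d).
Local Notation dvec := (seq (C * X)).
Implicit Types (u v : dvec) (f g h : E) (x y : X).

Definition ev v g : C := lin v (fun x => g.@[val x]).

Lemma evD v f g : ev v (f + g) = ev v f + ev v g.
Proof. by rewrite -linD; apply: eq_lin => x; rewrite mevalD. Qed.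
Lemma evZ v c f : ev v (c *: f) = c * ev v f.
Proof. by rewrite -linZ; apply: eq_lin => x; rewrite mevalZ. Qed.
Lemma evB v f g : ev v (f - g) = ev v f - ev v g.
Proof. by rewrite -scaleN1r evD evZ mulN1r. Qed.

Lemma normc_sum_CS (s : seq 'X_{1..d}) h (w : 'X_{1..d} -> C) : uniq s ->
  normc (\sum_(m <- s) h@_m * w m) <=
  hn h * Num.sqrt (\sum_(m <- s) normc (w m) ^+ 2).
Proof.
move=> us; pose q : E := \sum_(m <- s) Num.conj (w m) *: 'X_[m].
have ipq f : ip f q = \sum_(m <- s) f@_m * w m.
  rewrite ip_conj /q ip_suml rmorph_sum; apply: eq_bigr => m _ /=.
  by rewrite ipZl ipX rmorphM /= !conjCK mulrC.
suff -> : Num.sqrt (\sum_(m <- s) normc (w m) ^+ 2) = hn q.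
  by rewrite -ipq ip_CS.
rewrite /hn ipq; congr Num.sqrt.
have -> : \sum_(m <- s) q@_m * w m = (\sum_(m <- s) normc (w m) ^+ 2)%:C.
  rewrite rmorph_sum big_seq [RHS]big_seq; apply: eq_bigr => m ms.
  rewrite [RHS]/= -mulc_conj mulrC; congr (_ * _).
  rewrite /q raddf_sum /= (bigD1_seq m) //= mcoeffZ mcoeffX eqxx mulr1.
  rewrite big1 ?addr0 // => m' ne.
  by rewrite mcoeffZ mcoeffX (negbTE ne) mulr0.
by [].
Qed.

(** Cauchy-Schwarz. The squared weights decay like q^(4 |m|): the part q^(2N) gives smallness and
    the part q^|m| keeps the sum finite. With N = 0 this is a plain bound on a functional. *)
Lemma tail_bound (P : pred 'X_{1..d}) h (w : 'X_{1..d} -> C) (A q : R) N :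
  0 <= A -> 0 <= q -> q < 1 -> (forall m, P m -> (N <= mdeg m)%N) ->
  (forall m, normc (w m) <= A * (q ^+ 2) ^+ mdeg m) ->
  normc (\sum_(m <- msupp h | P m) h@_m * w m) <=
  A * Num.sqrt ((1 - q) ^- d) * q ^+ N * hn h.
Proof.
move=> A0 q0 q1 PN wA; rewrite -big_filter.
apply: le_trans (normc_sum_CS _ _ (filter_uniq _ (msupp_uniq _))) _.
rewrite mulrC ler_wpM2r ?hn_ge0 //.
have p : 0 <= (1 - q) ^- d by rewrite invr_ge0 exprn_ge0 // subr_ge0 ltW.
have -> : A * Num.sqrt ((1 - q) ^- d) * q ^+ N =
   Num.sqrt ((A * q ^+ N) ^+ 2 * (1 - q) ^- d).
  rewrite sqrtrM ?sqr_ge0 // sqrtr_sqr.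
  by rewrite ger0_norm ?mulr_ge0 ?exprn_ge0 // mulrAC.
rewrite ler_wsqrtr //.
apply: (@le_trans _ _ (\sum_(m <- [seq m <- msupp h | P m])
    (A * q ^+ N) ^+ 2 * q ^+ mdeg m)).
  rewrite big_seq [leRHS]big_seq; apply: ler_sum => m; rewrite mem_filter.
  move=> /andP[/PN Nm _].
  apply: (@le_trans _ _ ((A * (q ^+ 2) ^+ mdeg m) ^+ 2)).
    by rewrite ler_sqr ?nnegrE ?normc_ge0 ?wA // mulr_ge0 // exprn_ge0 ?sqr_ge0.
  have -> : (A * (q ^+ 2) ^+ mdeg m) ^+ 2 = A ^+ 2 * q ^+ (2 * mdeg m * 2).
    by rewrite exprMn -!exprM.
  have -> : (A * q ^+ N) ^+ 2 * q ^+ mdeg m = A ^+ 2 * q ^+ (N * 2 + mdeg m).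
    by rewrite exprMn -exprM -mulrA exprD.
  rewrite ler_wpM2l ?sqr_ge0 //.
  by apply: ler_wiXn2l => //; [exact: ltW | lia].
rewrite -mulr_sumr ler_wpM2l ?sqr_ge0 //; apply: geometric_mnm_le => //.
by rewrite filter_uniq ?msupp_uniq.
Qed.

Lemma polydisk_radius x : exists q : R,
  [/\ 0 <= q, q < 1 & forall j, normc (val x j) <= q ^+ 2].
Proof.
pose r : R := \big[Num.max/0]_(j < d) normc (val x j).
have r0 : 0 <= r by exact: bigmax_ge_id.
exists (Num.sqrt r); rewrite sqrtr_ge0; split => // [|j].
  rewrite -sqrtr1 ltr_sqrt //; apply: bigmax_lt => // j _.
  by rewrite -ltcR -normcR; exact: (forallP (valP x) j).
by rewrite sqr_sqrtr //; exact: le_bigmax.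
Qed.

Lemma mono_le (z : 'I_d -> C) (r : R) m :
  (forall j, normc (z j) <= r) -> normc (mono z m) <= r ^+ mdeg m.
Proof.
move=> zr; rewrite normc_prod mdegE -prodrXr; apply: ler_prod => j _.
by rewrite normcX exprn_ge0 ?normc_ge0 //= lerXn2r ?nnegrE ?normc_ge0 //
  (le_trans _ (zr j)) ?normc_ge0.
Qed.

(** The Szego kernel function at x, truncated to a box of exponents so that the inner product of two
    truncations factors over the variables. *)
Definition szego_poly N x : E :=
  \sum_(k : {ffun 'I_d -> 'I_N})
     Num.conj (mono (val x) (box_mnm k)) *: 'X_[box_mnm k].

Lemma ip_szego_poly N x h :
  ip h (szego_poly N x) = \sum_(k : {ffun 'I_d -> 'I_N})
    h@_(box_mnm k) * mono (val x) (box_mnm k).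
Proof.
rewrite ip_conj ip_suml rmorph_sum; apply: eq_bigr => k _.
by rewrite ipZl ipX /= rmorphM /= !conjCK mulrC.
Qed.

Lemma szego_poly_reproducing x : exists2 delta : nat -> R, vanishing delta &
  forall N h, normc (h.@[val x] - ip h (szego_poly N x)) <= delta N * hn h.
Proof.
have [q [q0 q1 xq]] := polydisk_radius x.
exists (fun N => Num.sqrt ((1 - q) ^- d) * q ^+ N).
  by apply: vanishingZ; rewrite ?sqrtr_ge0 //; exact: vanishing_geometric.
move=> N h; pose t := [seq box_mnm k | k : {ffun 'I_d -> 'I_N}].
have ut : uniq t by rewrite map_inj_uniq ?enum_uniq //; exact: box_mnm_inj.
have -> : ip h (szego_poly N x) =
    \sum_(m <- msupp h | m \in t) h@_m * mono (val x) m.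
  rewrite ip_szego_poly.
  have -> : \sum_(k : {ffun 'I_d -> 'I_N})
      h@_(box_mnm k) * mono (val x) (box_mnm k) =
    \sum_(m <- t) h@_m * mono (val x) m by rewrite /t big_map big_enum.
  rewrite [LHS](bigID (mem (msupp h))) /= [X in _ + X]big1; last first.
    by move=> m mh; rewrite memN_msupp_eq0 // mul0r.
  rewrite addr0.
  rewrite -[LHS]big_filter -[RHS]big_filter; apply: perm_big.
  apply: uniq_perm; rewrite ?filter_uniq ?msupp_uniq // => m.
  by rewrite !mem_filter andbC.
rewrite meval_sum (bigID (mem t)) /= addrAC subrr add0r.
rewrite -[Num.sqrt _]mul1r; apply: tail_bound => // m; last first.
  by rewrite mul1r; exact: mono_le.
by rewrite leqNgt; apply: contra => /box_mnmP.
Qed.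

Lemma meval_bounded x : exists2 B : R, 0 <= B &
  forall h, normc h.@[val x] <= B * hn h.
Proof.
have [q [q0 q1 xq]] := polydisk_radius x.
exists (Num.sqrt ((1 - q) ^- d)); first exact: sqrtr_ge0.
move=> h; rewrite meval_sum.
rewrite -[Num.sqrt _]mul1r -[_ * Num.sqrt _]mulr1 -(expr0 q).
by apply: tail_bound => // m; rewrite mul1r; exact: mono_le.
Qed.

End Evaluation.

Section Approximation.
Variables (R : realType) (d : nat).
Local Notation C := R[i].
Local Notation E := {mpoly C[d]}.
Local Notation X := (polydisk R d).
Local Notation dvec := (seq (C * X)).
Implicit Types (u v : dvec) (f g h : E) (x y : X).

Lemma lin_meval_bounded (k : X -> C) v : exists2 B : R, 0 <= B &
  forall h, normc (lin v (fun x => k x * h.@[val x])) <= B * hn h.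
Proof.
elim: v => [|a v [B B0 HB]].
  by exists 0 => // h; rewrite /lin big_nil normc0 mul0r.
have [B' B'0 HB'] := meval_bounded a.2.
exists (normc (Num.conj a.1 * k a.2) * B' + B).
  by rewrite addr_ge0 ?mulr_ge0 ?normc_ge0.
move=> h; rewrite /lin big_cons; apply: le_trans (normcD_le _ _) _.
rewrite mulrDl; apply: lerD; last exact: HB.
by rewrite mulrA normcM -mulrA ler_wpM2l ?normc_ge0.
Qed.

(* A discrete Fourier transform of the values at the points of a torus of radius
   1/4 isolates the coefficient of z^c up to the aliased ones. *)
Lemma approx_mnm (c : 'X_{1..d}) (e : R) : 0 < e ->
  exists v, forall h, normc (ev v h - ip h 'X_[c]) <= e * hn h.
Proof.
(* 4^|c| undoes the radius 1/4; the square root is the constant of [tail_bound] for q = 1/2, since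
   q^2 = 1/4. *)
move=> e0; pose B : R := 4 ^+ mdeg c * Num.sqrt ((1 - 2^-1) ^- d).
have B0 : 0 <= B by rewrite mulr_ge0 ?exprn_ge0 ?sqrtr_ge0.
have [n0 nP] : exists n0, forall n, (n0 <= n)%N -> B * 2^-1 ^+ n <= e.
  by apply: vanishingZ e0 => //; apply: vanishing_geometric; lra.
(* N > |c| forces every aliased exponent other than c to reach N in some variable; N >= n0 makes
   their total contribution small. *)
pose N := (n0 + mdeg c).+1.
have [z zP] := @prim_root_exists R N isT.
pose pt (k : {ffun 'I_d -> 'I_N}) := [ffun j => torus_pt z 4^-1 k j].
have ptP k : [forall j, `|pt k j| < 1].
  apply/forallP => j; rewrite ffunE /torus_pt normrM normrX.
  rewrite (prim_root_norm _ zP) // expr1n mulr1 normcR ltcR normc_real.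
  by rewrite ger0_norm ?invr_ge0 // invf_lt1; lra.
pose x k : X := exist _ (pt k) (ptP k).
pose K : C := (4 ^+ mdeg c)%:C / (N ^ d)%:R.
exists [seq (Num.conj (K * Num.conj (mono (torus_pt z 1 k) c)), x k)
  | k : {ffun 'I_d -> 'I_N}] => h.
have Nd : ((N ^ d)%:R : C) != 0 by rewrite pnatr_eq0 -lt0n expn_gt0.
have -> : ev [seq (Num.conj (K * Num.conj (mono (torus_pt z 1 k) c)), x k)
    | k : {ffun 'I_d -> 'I_N}] h =
  \sum_(m <- msupp h | [forall j, m j == c j %[mod N]])
     h@_m * ((4 ^+ mdeg c)%:C * (4^-1 ^+ mdeg m)%:C).
  rewrite /ev /lin big_map big_enum /=.
  under eq_bigr => k _.
    rewrite conjCK (@meval_eq _ _ _ (torus_pt z 4^-1 k)) => [|j]; last first.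
      by rewrite ffunE.
    rewrite meval_sum mulr_sumr.
    over.
  have rearrange (r a b t w : C) : r * a * (b * (t * w)) = b * r * t * (w * a).
    by ring.
  rewrite exchange_big /= [RHS]big_mkcond; apply: eq_bigr => m _ /=.
  rewrite (eq_bigr (fun k => h@_m * K * (4^-1 ^+ mdeg m)%:C *
     (mono (torus_pt z 1 k) m * Num.conj (mono (torus_pt z 1 k) c)))).
    2: by move=> k _; rewrite (mono_torus_pt _ 4^-1); exact: rearrange.
  rewrite -mulr_sumr (mono_sum _ zP) //; case: ifP => _; last by rewrite mulr0.
  by rewrite /K; field.
have cdeg j : (c j <= mdeg c)%N by rewrite mdegE (bigD1 j) //= leq_addr.
have -> : ip h 'X_[c] = \sum_(m <- msupp h | m == c)
     h@_m * ((4 ^+ mdeg c)%:C * (4^-1 ^+ mdeg m)%:C).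
  rewrite ipXr; have [ch|nch] := boolP (c \in msupp h).
    rewrite -big_filter filter_pred1_uniq ?msupp_uniq // big_seq1.
    rewrite -rmorphM /= -exprMn divff ?expr1n ?mulr1 // pnatr_eq0 //.
  rewrite memN_msupp_eq0 // big_seq_cond big1 // => m /andP[mh /eqP mc].
  by rewrite -mc mh in nch.
rewrite (bigID (pred1 c)) /=.
have -> : \sum_(m <- msupp h | [forall j, m j == c j %[mod N]] && (m == c))
    h@_m * ((4 ^+ mdeg c)%:C * (4^-1 ^+ mdeg m)%:C) =
  \sum_(m <- msupp h | m == c) h@_m * ((4 ^+ mdeg c)%:C * (4^-1 ^+ mdeg m)%:C).
  apply: eq_bigl => m; case: eqVneq => [->|_]; rewrite ?andbF // andbT.
  by apply/forallP => j.
rewrite addrAC subrr add0r.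
apply: (@le_trans _ _ (B * 2^-1 ^+ N * hn h)).
  apply: tail_bound; rewrite ?exprn_ge0 //; try lra.
  - move=> m /andP[/forallP mc ne].
    have /forallPn[j mj] : ~~ [forall j, m j == c j].
      by apply: contra ne => /forallP H; apply/eqP/mnmP => j'; exact/eqP.
    have mN : (N <= m j)%N.
      rewrite leqNgt; apply/negP => mN; move: (mc j) mj.
      rewrite !modn_small //; first by move=> ->.
      by rewrite /N; have := cdeg j; lia.
    by apply: leq_trans mN _; rewrite mdegE (bigD1 j) //= leq_addr.
  move=> m; rewrite -rmorphM normc_real.
  rewrite ger0_norm ?mulr_ge0 ?exprn_ge0 ?invr_ge0 //.
  have -> : (2^-1 : R) ^+ 2 = 4^-1 by field.
  by [].
by rewrite ler_wpM2r ?hn_ge0 // nP // /N; lia.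
Qed.

(** Density of the kernel functions in H^2: the passage from a polynomial to a finitely supported
    vector, one term of f at a time. *)
Lemma approx_poly f (e : R) : 0 < e ->
  exists v, forall h, normc (ev v h - ip h f) <= e * hn h.
Proof.
rewrite [f]mpolyE; elim: (msupp f) e => [|m s IH] e e0.
  exists [::] => h; rewrite big_nil ip0r /ev /lin big_nil subrr normc0.
  by rewrite mulr_ge0 ?hn_ge0 // ltW.
set q := (X in _ :: X) in IH *; pose a := f@_m.
have a1 : 0 < 2 * (normc a + 1) by rewrite mulr_gt0 // ltr_wpDl ?normc_ge0.
have [v1 H1] := @approx_mnm m (e / (2 * (normc a + 1))) (divr_gt0 e0 a1).
have [|v2 H2] := IH (e / 2); first by rewrite divr_gt0.
exists (mulv (fun=> Num.conj a) v1 ++ v2) => h; rewrite big_cons ipDr ipZr.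
have -> : ev (mulv (fun=> Num.conj a) v1 ++ v2) h =
    Num.conj a * ev v1 h + ev v2 h by rewrite /ev lin_cat lin_mulv linZ.
rewrite opprD addrACA -mulrBr; apply: le_trans (normcD_le _ _) _.
rewrite normcM normc_conj.
have := H1 h; have := H2 h; have := normc_ge0 a; have := hn_ge0 h.
set n1 := normc (ev v1 h - _); set n2 := normc (ev v2 h - _).
move=> hh na I2 I1.
have : normc a * n1 <= (normc a + 1) * (e / (2 * (normc a + 1)) * hn h).
  by apply: ler_pM; rewrite ?normc_ge0 // lerDl.
have -> : (normc a + 1) * (e / (2 * (normc a + 1)) * hn h) = e / 2 * hn h.
  by field; rewrite gt_eqF // ltr_wpDl.
lra.
Qed.

End Approximation.

(** * Kernels of closures of spaces of polynomials *)

Section RealBounds.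
Variable R : realType.
Implicit Types (q t r b : R).

(** Here q is the norm of an approximate kernel function, r its value at its own point and t its
    error; such norms are thus bounded uniformly. *)
Lemma ler_selfbound q t r b : 0 <= q -> 0 <= b -> t <= 1 ->
  q ^+ 2 - r <= t * q -> r <= b * q -> q <= b + 1.
Proof.
move=> q0 b0 t1 h1 h2; have [->|qn] := eqVneq q 0; first lra.
have qp : 0 < q by rewrite lt_def qn.
by rewrite -(ler_pM2l qp); nra.
Qed.

Lemma ler_sum2_common (r1 r2 t1 t2 q b : R) : 0 <= t1 -> 0 <= t2 -> q <= b ->
  r1 <= t1 * q -> r2 <= t2 * q -> r1 + r2 <= b * (t1 + t2).
Proof. nra. Qed.

End RealBounds.

Section Representation.
Variables (R : realType) (d : nat).
Local Notation C := R[i].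
Local Notation E := {mpoly C[d]}.
Local Notation X := (polydisk R d).
Local Notation dvec := (seq (C * X)).
Implicit Types (u v : dvec) (f g h : E) (x y : X) (W : E -> Prop).

Definition subspace W : Prop :=
  W 0 /\ forall c f g, W f -> W g -> W (c *: f + g).

Lemma subspaceZ W c f : subspace W -> W f -> W (c *: f).
Proof. by move=> [W0 WL] Wf; rewrite -[_ *: _]addr0; exact: WL. Qed.

Lemma subspaceD W f g : subspace W -> W f -> W g -> W (f + g).
Proof. by move=> [W0 WL] Wf Wg; rewrite -[f]scale1r; exact: WL. Qed.

(* [k] is the reproducing kernel of the closure of [W]: the polynomial [g] is
   close to the projection of the functional [ev v] onto that closure. *)
Definition represents W (k : kernel R d) : Prop :=
  forall v (e : R), 0 < e -> exists g, [/\ W g,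
    forall h, W h -> normc (ev v h - ip h g) <= e * hn h &
    normc (qf k v - (hn g ^+ 2)%:C) <= e].

Lemma represents_pointwise W k (G : nat -> X -> E) : subspace W ->
  (forall n x, W (G n x)) ->
  (forall x, exists2 delta : nat -> R, vanishing delta &
     forall n h, W h ->
       normc (h.@[val x] - ip h (G n x)) <= delta n * hn h) ->
  (forall x y, vanishing (fun n => normc (k x y - ip (G n y) (G n x)))) ->
  represents W k.
Proof.
move=> sW WG Gr Gk v e e0.
have near x : exists dl : nat -> R, vanishing dl /\
    forall n h, W h -> normc (h.@[val x] - ip h (G n x)) <= dl n * hn h.
  by have [dl d1 d2] := Gr x; exists dl.
have [delta deltaP] := choice near.
pose Gv n : E := \sum_(a <- v) a.1 *: G n a.2.
have WGv n : W (Gv n).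
  rewrite /Gv; elim: (v) => [|a s IH]; first by rewrite big_nil; exact: sW.1.
  by rewrite big_cons; apply: sW.2.
have ipG h n : ip h (Gv n) = \sum_(a <- v) Num.conj a.1 * ip h (G n a.2).
  rewrite ip_conj ip_suml rmorph_sum; apply: eq_bigr => a _ /=.
  by rewrite ipZl rmorphM /= -ip_conj.
have [n1 H1] : exists n0, forall n, (n0 <= n)%N ->
    \sum_(a <- v) normc a.1 * delta a.2 n <= e.
  apply: (vanishing_sum v (c := fun a => normc a.1)
    (u := fun a => delta a.2) _ _ e0) => a; first exact: normc_ge0.
  by have [] := deltaP a.2.
have [n2 H2] : exists n0, forall n, (n0 <= n)%N ->
    \sum_(a <- v) 1 * (\sum_(b <- v) (normc a.1 * normc b.1) *
      normc (k a.2 b.2 - ip (G n b.2) (G n a.2))) <= e.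
  apply: (vanishing_sum v (c := fun=> 1) (u := fun a n => \sum_(b <- v)
    (normc a.1 * normc b.1) * normc (k a.2 b.2 - ip (G n b.2) (G n a.2)))
    _ _ e0) => // a.
  apply: (vanishing_sum v (c := fun b => normc a.1 * normc b.1)
    (u := fun b n => normc (k a.2 b.2 - ip (G n b.2) (G n a.2)))) => // b.
  by rewrite mulr_ge0 ?normc_ge0.
pose n := maxn n1 n2; exists (Gv n); split => // [h Wh|].
  rewrite ipG /ev /lin -sumrB; apply: le_trans (normc_sum_le _ _ _) _.
  apply: (@le_trans _ _ ((\sum_(a <- v) normc a.1 * delta a.2 n) * hn h)).
    rewrite mulr_suml; apply: ler_sum => a _.
    rewrite -mulrBr normcM normc_conj -mulrA ler_wpM2l ?normc_ge0 //.
    by have [_] := deltaP a.2; apply.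
  by rewrite ler_wpM2r ?hn_ge0 // H1 // leq_maxl.
apply: le_trans (H2 n (leq_maxr _ _)).
rewrite -ip_self ipG /qf bqE -sumrB; apply: le_trans (normc_sum_le _ _ _) _.
apply: ler_sum => a _; rewrite mul1r ip_suml mulr_sumr -sumrB.
apply: le_trans (normc_sum_le _ _ _) _; apply: ler_sum => b _.
have E (p q r t : C) : p * q * r - p * (r * t) = p * r * (q - t) by ring.
by rewrite ipZl E !normcM normc_conj.
Qed.

(** The limit is the supremum of the lower bounds a n - B / (n + 1) that the Cauchy rate
    provides. *)
Lemma real_limit (a : nat -> R) (B : R) : 0 <= B ->
  (forall n m, `|a n - a m| <= B * (n.+1%:R^-1 + m.+1%:R^-1)) ->
  exists l, forall n, `|l - a n| <= B * n.+1%:R^-1.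
Proof.
move=> B0 H; pose b n := a n - B * n.+1%:R^-1.
pose A : set R := fun r => exists n, r = b n.
have ubA m : ubound A (a m + B * m.+1%:R^-1).
  move=> _ [n ->]; rewrite /b; have := ler_norm (a n - a m); have := H n m.
  move: `|_| (n.+1%:R^-1) (m.+1%:R^-1) => r t1 t2; nra.
have hA : has_sup A.
  by split; [exists (b 0%N), 0%N | exists (a 0%N + B * 1%:R^-1)].
exists (sup A) => n.
have An : A (b n) by exists n.
have := sup_upper_bound hA An.
have : sup A <= a n + B * n.+1%:R^-1 by apply: ge_sup => //; exact: hA.1.
rewrite /b ler_norml; move: (sup A) (n.+1%:R^-1) => r t; lra.
Qed.

Lemma complex_limit (a : nat -> C) (B : R) : 0 <= B ->
  (forall n m, normc (a n - a m) <= B * (n.+1%:R^-1 + m.+1%:R^-1)) ->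
  exists l, forall n, normc (l - a n) <= 2 * B * n.+1%:R^-1.
Proof.
move=> B0 H.
have Im_le (z : C) : `|complex.Im z| <= normc z.
  by case: z => p q /=; rewrite -sqrtr_sqr ler_sqrt ?lerDr ?addr_ge0 ?sqr_ge0.
have Re_le (z : C) : `|complex.Re z| <= normc z.
  by case: z => p q /=; rewrite -sqrtr_sqr ler_sqrt ?lerDl ?addr_ge0 ?sqr_ge0.
have [l1 L1] : exists l, forall n, `|l - complex.Re (a n)| <= B * n.+1%:R^-1.
  apply: real_limit => // n m; apply: le_trans (H n m).
  by rewrite -ReB; exact: Re_le.
have [l2 L2] : exists l, forall n, `|l - complex.Im (a n)| <= B * n.+1%:R^-1.
  apply: real_limit => // n m; apply: le_trans (H n m).
  have -> : complex.Im (a n) - complex.Im (a m) = complex.Im (a n - a m).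
    by case: (a n); case: (a m).
  exact: Im_le.
exists (Complex l1 l2) => n.
have -> : Complex l1 l2 - a n =
   (l1 - complex.Re (a n))%:C + (l2 - complex.Im (a n))%:C * 'i.
  case: (a n) => p q; apply/eqP; rewrite eq_complex /=.
  by apply/andP; split; apply/eqP; ring.
apply: le_trans (normcD_le _ _) _; rewrite normcM !normc_real.
have -> : normc ('i : C) = 1 by rewrite /= expr0n expr1n add0r sqrtr1.
rewrite mulr1; have := L1 n; have := L2 n.
move: `|_| `|_| (n.+1%:R^-1) => r1 r2 t; lra.
Qed.

Section Represented.
Variables (W : E -> Prop) (k : kernel R d).
Hypotheses (sW : subspace W) (Wk : represents W k).

Lemma represents_Im v : complex.Im (qf k v) = 0.
Proof.
apply/eqP; rewrite -normr_eq0 eq_le normr_ge0 andbT.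
apply: (@ler_addeps _ _ _ 1) => e e0 _; rewrite add0r mul1r.
have [g [_ _]] := Wk v e0; apply: le_trans.
have -> : complex.Im (qf k v) = complex.Im (qf k v - (hn g ^+ 2)%:C).
  by case: (qf k v) => p q /=; rewrite subr0.
set z := _ - _; case: z => p q /=.
by rewrite -sqrtr_sqr ler_sqrt ?lerDr ?addr_ge0 ?sqr_ge0.
Qed.

Lemma represents_rq v : qf k v = (rq k v)%:C.
Proof. by rewrite [LHS]complexE represents_Im mulr0 addr0. Qed.

Lemma represents_near v (e : R) : 0 < e -> exists g, [/\ W g,
    forall h, W h -> normc (ev v h - ip h g) <= e * hn h &
    `|rq k v - hn g ^+ 2| <= e].
Proof.
move=> e0; have [g [Wg H1 H2]] := Wk v e0; exists g; split=> //.
by move: H2; rewrite represents_rq -rmorphB normc_real.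
Qed.

(** From |h - g|^2 >= 0 for a near-projection g. Together with [represents_le], which tests its
    hypothesis at g itself, this identifies [rq k v] with a supremum. *)
Lemma represents_ub v h : W h ->
  2 * complex.Re (ev v h) - hn h ^+ 2 <= rq k v.
Proof.
move=> Wh; apply: (@ler_addeps _ _ _ (2 * hn h + 1)) => e e0 _.
have [g [_ /(_ h Wh) H1 H2]] := represents_near v e0.
have := Re_le_normc (ev v h - ip h g); rewrite ReB.
have := sqr_ge0 (hn (h - g)); rewrite hn_sqrB.
have := ler_norm (hn g ^+ 2 - rq k v); rewrite distrC; lra.
Qed.

Lemma represents_rq_ge0 v : 0 <= rq k v.
Proof.
have := represents_ub v sW.1; rewrite hn0 /ev.
have -> : lin v (fun x => (0 : E).@[val x]) = 0.
  by rewrite /lin big1 // => a _; rewrite meval0 mulr0.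
by rewrite /= expr0n /= mulr0 subr0.
Qed.

Lemma represents_pos : pos_kernel k.
Proof. by move=> v; rewrite represents_rq ler0c represents_rq_ge0. Qed.

Lemma represents_le v (c : R) : 
  (forall h, W h -> 2 * complex.Re (ev v h) - hn h ^+ 2 <= c) -> rq k v <= c.
Proof.
(* The square of [hn g] is at most [rq k v + 1], so [hn g] is at most [rq k v + 2] and the factor of
   e does not involve g. *)
move=> H; apply: (@ler_addeps _ _ _ (2 * (rq k v + 2) + 1)) => e e0 e1.
have [g [Wg H1 H2]] := represents_near v e0.
have := H g Wg; have := Re_le_normc (ip g g - ev v g).
rewrite normc_distC ReB -hn_sqr; have := H1 g Wg.
have := ler_norm (hn g ^+ 2 - rq k v); rewrite distrC.
have := ler_norm (rq k v - hn g ^+ 2).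
have := hn_ge0 g => g0 h1 h2 h3 h4 h5.
have : hn g <= rq k v + 2 by nra.
nra.
Qed.

Lemma represents_le_bound v (c : R) : 0 <= c ->
  (forall h, W h -> normc (ev v h) <= c * hn h) -> rq k v <= c ^+ 2.
Proof.
move=> c0 H; apply: represents_le => h Wh.
have := H h Wh; have := Re_le_normc (ev v h); have := sqr_ge0 (c - hn h); nra.
Qed.

End Represented.

(** Near-maximisers of 2 Re h(x) - |h|^2 over W play the part of the kernel function at x, which
    lies only in the closure of W; the kernel is the limit of their inner products. *)
Lemma kernel_exists W : subspace W -> exists k, represents W k.
Proof.
move=> sW.
have near x (t : R) : 0 < t -> exists g, W g /\ forall h, W h ->
    normc (h.@[val x] - ip h g) <= t * hn h.
  move=> t0.
  have [B B0 HB] := meval_bounded x.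
  pose A : set R := fun r =>
    exists2 h, W h & r = 2 * complex.Re h.@[val x] - hn h ^+ 2.
  have hA : has_sup A.
    split.
      by exists (2 * complex.Re (0 : E).@[val x] - hn (0 : E) ^+ 2), 0;
        [exact: sW.1 | ].
    exists (B ^+ 2) => _ [h Wh ->].
    have := HB h; have := Re_le_normc h.@[val x].
    have := sqr_ge0 (B - hn h).
    by move: (complex.Re _) (normc _) (hn h) => r1 r2 r3; lra.
  have [_ [g Wg ->] gA] := sup_adherent (exprn_gt0 2 t0) hA.
  exists g; split=> //.
  apply: (lin_bound (W := W) (l := fun h => h.@[val x] - ip h g)).
  - exact: ltW.
  - by move=> c f; exact: subspaceZ.
  - by move=> c f; rewrite mevalZ ipZl mulrBr.
  (* Comparing g with the competitor h + g leaves 2 Re (h(x) - <h, g>) <= t^2 + |h|^2, as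
     [lin_bound] requires. *)
  move=> h Wh; have : A (2 * complex.Re (h + g).@[val x] - hn (h + g) ^+ 2).
    by exists (h + g) => //; exact: subspaceD.
  move=> /(sup_upper_bound hA); rewrite mevalD ReD hn_sqrD ReB.
  move: gA; move: (sup A) (complex.Re h.@[val x]) (complex.Re (ip h g))
    (complex.Re g.@[val x]) (hn h) (hn g) => r1 r2 r3 r4 r5 r6.
  by lra.
have t_gt0 n : 0 < (n.+1%:R^-1 : R) by rewrite invr_gt0 ltr0n.
have [G0 GP] := choice (fun xn : X * nat => near xn.1 _ (t_gt0 xn.2)).
pose G x n := G0 (x, n); have {}GP x n : W (G x n) /\ forall h, W h ->
  normc (h.@[val x] - ip h (G x n)) <= n.+1%:R^-1 * hn h := GP (x, n).
have GB x : exists2 B : R, 0 <= B & forall n, hn (G x n) <= B.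
  have [B B0 HB] := meval_bounded x; exists (B + 1) => [|n]; first lra.
  have [WG GR] := GP x n.
  have t1 : (n.+1%:R^-1 : R) <= 1 by rewrite invf_le1 ?ler1n ?ltr0n.
  apply: (ler_selfbound (r := complex.Re (G x n).@[val x]) (hn_ge0 _) B0 t1).
    rewrite hn_sqr -ReB; apply: le_trans (Re_le_normc _) _.
    by rewrite normc_distC; exact: GR.
  exact: le_trans (Re_le_normc _) (HB _).
have lim (xy : X * X) : exists l, vanishing (fun n =>
    normc (l - ip (G xy.2 n) (G xy.1 n))).
  case: xy => x y /=.
  have [Bx Bx0 HBx] := GB x; have [By By0 HBy] := GB y.
  have [|l L] := @complex_limit (fun n => ip (G y n) (G x n)) (Bx + By)
     (addr_ge0 Bx0 By0); last first.
    exists l; apply: vanishing_le (L) _; apply: vanishingZ; first lra.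
    exact: vanishing_harmonic.
  move=> n m.
  have [_ Gxn] := GP x n; have [_ Gxm] := GP x m.
  have [_ Gyn] := GP y n; have [_ Gym] := GP y m.
  have T (a b z : C) : normc (a - b) <= normc (z - a) + normc (z - b).
    have -> : a - b = (z - b) - (z - a) by ring.
    by rewrite [leRHS]addrC normcB_le.
  (* Both inner products approximate the value of [G y n] at x, so they differ by at most the sum of
     the two errors. *)
  have A1 : normc (ip (G y n) (G x n) - ip (G y n) (G x m)) <=
      By * (n.+1%:R^-1 + m.+1%:R^-1).
    apply: le_trans (T _ _ (G y n).@[val x]) _.
    apply: (ler_sum2_common (ltW (t_gt0 n)) (ltW (t_gt0 m)) (HBy n)).
      exact: Gxn (GP y n).1.
    exact: Gxm (GP y n).1.
  have A2 : normc (ip (G y n) (G x m) - ip (G y m) (G x m)) <=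
      Bx * (n.+1%:R^-1 + m.+1%:R^-1).
    rewrite ![ip (G y _) _]ip_conj -rmorphB normc_conj.
    apply: le_trans (T _ _ (G x m).@[val y]) _.
    apply: (ler_sum2_common (ltW (t_gt0 n)) (ltW (t_gt0 m)) (HBx m)).
      exact: Gyn (GP x m).1.
    exact: Gym (GP x m).1.
  have -> : ip (G y n) (G x n) - ip (G y m) (G x m) =
    (ip (G y n) (G x n) - ip (G y n) (G x m)) +
    (ip (G y n) (G x m) - ip (G y m) (G x m)) by ring.
  apply: le_trans (normcD_le _ _) _; move: A1 A2.
  by move: (normc _) (normc _) (n.+1%:R^-1) (m.+1%:R^-1) => r1 r2 t1 t2; lra.
have [k kP] := choice lim; exists (fun x y => k (x, y)).
apply: (represents_pointwise (G := fun n x => G x n) sW).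
- by move=> n x; exact: (GP x n).1.
- move=> x; exists (fun n => n.+1%:R^-1); first exact: vanishing_harmonic.
  by move=> n; exact: (GP x n).2.
by move=> x y; exact: (kP (x, y)).
Qed.

Definition szego : kernel R d :=
  fun z w => (\prod_j (1 - val z j * Num.conj (val w j)))^-1.

(** Two truncated kernel functions pair to the Szego kernel times the product of the 1 - q_j^n,
    which tends to 1 because |q_j| < 1. *)
Lemma szego_represents : represents (fun=> True) szego.
Proof.
apply: (represents_pointwise (G := @szego_poly R d)) => //.
  by move=> x; have [dl d1 d2] := szego_poly_reproducing x; exists dl.
move=> x y.
pose q j := val x j * Num.conj (val y j).
have qlt j : normc (q j) < 1.
  rewrite -ltcR -normcR normrM norm_conjC.
  have := forallP (valP x) j; have := forallP (valP y) j => y1 x1.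
  by rewrite (le_lt_trans _ x1) // ler_piMr // ltW.
have q1 j : 1 - q j != 0.
  apply/eqP => /subr0_eq e; have := qlt j.
  by rewrite -e normc1 ltxx.
have ipE n : ip (szego_poly n y) (szego_poly n x) =
    szego x y * \prod_j (1 - q j ^+ n).
  rewrite ip_szego_poly.
  have -> : \sum_(k : {ffun 'I_d -> 'I_n}) (szego_poly n y)@_(box_mnm k) *
      mono (val x) (box_mnm k) =
      \sum_(k : {ffun 'I_d -> 'I_n}) \prod_j q j ^+ k j.
    apply: eq_bigr => k _.
    have -> : (szego_poly n y)@_(box_mnm k) =
        Num.conj (mono (val y) (box_mnm k)).
      rewrite /szego_poly raddf_sum /= (bigD1 k) //= mcoeffZ mcoeffX eqxx mulr1.
      rewrite big1 ?addr0 // => l lk; rewrite mcoeffZ mcoeffX.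
      by rewrite (inj_eq (@box_mnm_inj d n)) (negbTE lk) mulr0.
    rewrite rmorph_prod mulrC -big_split /=; apply: eq_bigr => j _.
    by rewrite rmorphXn -exprMn mnmE.
  rewrite -(bigA_distr_bigA (fun j (k : 'I_n) => q j ^+ k)) /szego -prodfV.
  rewrite -big_split /=; apply: eq_bigr => j _.
  apply: (mulfI (q1 j)); rewrite mulrA divff // mul1r.
  by rewrite -opprB mulNr -subrX1 opprB.
have van1 (a b : nat -> C) : vanishing (fun n => normc (1 - a n)) ->
    vanishing (fun n => normc (1 - b n)) ->
    vanishing (fun n => normc (1 - a n * b n)).
  move=> va vb e e0; pose e' := Num.min 1 (e / 3).
  have e'0 : 0 < e' by rewrite lt_min ltr01 divr_gt0.
  have [n1 H1] := va _ e'0; have [n2 H2] := vb _ e'0.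
  exists (maxn n1 n2) => n; rewrite geq_max => /andP[/H1 h1 /H2 h2].
  have -> : 1 - a n * b n = (1 - a n) + a n * (1 - b n) by ring.
  apply: le_trans (normcD_le _ _) _; rewrite normcM.
  have a2 : normc (a n) <= 1 + normc (1 - a n).
    by rewrite -{1}[a n](subKr 1) -normc1 normcB_le.
  have e'1 : e' <= 1 by rewrite ge_min lexx.
  have e'3 : e' <= e / 3 by rewrite ge_min lexx orbT.
  have := normc_ge0 (1 - b n); have := normc_ge0 (a n); nra.
have vprod : vanishing (fun n => normc (1 - \prod_j (1 - q j ^+ n))).
  elim: (index_enum _) => [|j r IH].
    by apply: vanishing_le (@vanishing0 R) => n; rewrite big_nil subrr normc0.
  apply: (@vanishing_le _ _ (fun n =>
    normc (1 - (1 - q j ^+ n) * \prod_(j <- r) (1 - q j ^+ n)))).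
    by move=> n; rewrite big_cons.
  apply: van1 => //; apply: (@vanishing_le _ _ (fun n => normc (q j) ^+ n)).
    by move=> n; rewrite subKr normcX.
  by apply: vanishing_geometric; rewrite ?normc_ge0.
apply: (@vanishing_le _ _ (fun n => normc (szego x y) *
    normc (1 - \prod_j (1 - q j ^+ n)))); last first.
  by apply: vanishingZ; rewrite ?normc_ge0.
by move=> n; rewrite ipE -normcM mulrBr mulr1.
Qed.

(** The left side of the conclusion is the squared H^2 distance from g to the kernel vector of v.
    With [dual_norm_le], it is the squared norm of the functional sending h to [ev v h - ip h g]. *)
Lemma dual_norm_ge v g (c : R) : 0 <= c ->
  (forall h, normc (ev v h - ip h g) <= c * hn h) ->
  rq szego v - 2 * complex.Re (ev v g) + hn g ^+ 2 <= c ^+ 2.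
Proof.
move=> c0 H.
suff : rq szego v <= c ^+ 2 + 2 * complex.Re (ev v g) - hn g ^+ 2 by lra.
apply: (represents_le szego_represents) => h _.
have := H (h - g); rewrite evB ipBl => H1.
have := Re_le_normc (ev v h - ev v g - (ip h g - ip g g)).
rewrite !ReB -hn_sqr; have := hn_sqrB h g; have := sqr_ge0 (c - hn (h - g)).
nra.
Qed.

Lemma dual_norm_le v g (c : R) : 0 <= c ->
  rq szego v - 2 * complex.Re (ev v g) + hn g ^+ 2 <= c ^+ 2 ->
  forall h, normc (ev v h - ip h g) <= c * hn h.
Proof.
move=> c0 H h.
apply: (lin_bound (W := fun=> True) (l := fun h => ev v h - ip h g)) => //.
  by move=> a f; rewrite evZ ipZl mulrBr.
move=> f _; have := represents_ub szego_represents v (h := g + f) I.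
rewrite evD ReD hn_sqrD ReB [ip f g]ip_conj Re_conj; lra.
Qed.

End Representation.

(** * Contractivity and complementary kernels *)

Section Criteria.
Variables (R : realType) (d : nat).
Local Notation C := R[i].
Local Notation X := (polydisk R d).
Local Notation dvec := (seq (C * X)).
Implicit Types (u v w : dvec) (K L : kernel R d) (k f : X -> C).

Lemma pos_kernelB K L : pos_kernel K -> pos_kernel L ->
  (forall v, rq L v <= rq K v) -> pos_kernel (fun z y => K z y - L z y).
Proof.
move=> pK pL H v; rewrite qfB (pos_qfE v pK) (pos_qfE v pL).
by rewrite -rmorphB ler0c subr_ge0.
Qed.

Lemma pos_kernelB_le K L v :
  pos_kernel (fun z y => K z y - L z y) -> rq L v <= rq K v.
Proof. by move=> /pos_rq-/(_ v); rewrite rqB subr_ge0. Qed.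

Lemma eq_pos_kernel K L : (forall z y, K z y = L z y) ->
  pos_kernel K -> pos_kernel L.
Proof. by move=> KL pK v; rewrite -(eq_qf v KL). Qed.

Definition conj_kernel k K : kernel R d :=
  fun z y => k z * K z y * Num.conj (k y).

Lemma pos_conj_kernel k K : pos_kernel K -> pos_kernel (conj_kernel k K).
Proof. by move=> pK v; rewrite -qf_mulv. Qed.

Definition coord (j : 'I_d) (x : X) : C := val x j.

(** The kernel in the conclusion is K minus its conjugate by z_j, and the form of that conjugate is
    [rq K] after [mulv (coord j)]. The converse is [contractive_le]. *)
Lemma contractive_kernel j K : pos_kernel K ->
  (forall v, rq K (mulv (coord j) v) <= rq K v) ->
  pos_kernel (fun z y => (1 - val z j * Num.conj (val y j)) * K z y).
Proof.
move=> pK H.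
apply: (@eq_pos_kernel (fun z y => K z y - conj_kernel (coord j) K z y)).
  by move=> z y; rewrite /conj_kernel /coord mulrBl mul1r mulrAC.
apply: pos_kernelB => //; first exact: pos_conj_kernel.
by move=> v; rewrite /rq -qf_mulv; exact: H.
Qed.

Lemma contractive_le j K v :
  pos_kernel (fun z y => (1 - val z j * Num.conj (val y j)) * K z y) ->
  rq K (mulv (coord j) v) <= rq K v.
Proof.
move=> pK; rewrite /rq qf_mulv; apply: pos_kernelB_le.
apply: eq_pos_kernel pK => z y.
by rewrite /coord mulrBl mul1r [in RHS]mulrAC.
Qed.

Lemma rq_mulvM k1 k2 K v :
  rq K (mulv (fun x => k1 x * k2 x) v) = rq K (mulv k1 (mulv k2 v)).
Proof.
rewrite /rq !qf_mulv; congr complex.Re; apply: eq_qf => z y.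
rewrite rmorphM /=; move: (Num.conj _) (Num.conj _) => c1 c2; ring.
Qed.

Lemma contractive_mono_le (S : {set 'I_d}) K (a : 'X_{1..d}) v :
  (forall j, j \in S -> forall w, rq K (mulv (coord j) w) <= rq K w) ->
  (forall j, j \notin S -> a j = 0%N) ->
  rq K (mulv (fun x => mono (val x) a) v) <= rq K v.
Proof.
move=> H a0; rewrite /mono.
have rq1 w : rq K (mulv (fun=> 1) w) = rq K w.
  rewrite /rq qf_mulv; congr complex.Re; apply: eq_qf => z y.
  by rewrite mul1r rmorph1 mulr1.
elim: (index_enum _) v => [|j r IH] v.
  have -> : (fun x : X => \prod_(i <- [::]) val x i ^+ a i) = fun=> 1.
    by apply/funext => x; rewrite big_nil.
  by rewrite rq1.
have -> : (fun x : X => \prod_(i <- j :: r) val x i ^+ a i) =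
    fun x => (val x j ^+ a j) * \prod_(i <- r) val x i ^+ a i.
  by apply/funext => x; rewrite big_cons.
rewrite rq_mulvM; apply: le_trans (IH v); move: (mulv _ v) => w.
have [jS|/a0 ->] := boolP (j \in S); last by rewrite rq1.
elim: (a j) w => [|m IHm] w; first by rewrite rq1.
have -> : (fun x : X => val x j ^+ m.+1) = fun x => coord j x * val x j ^+ m.
  by apply/funext => x; rewrite exprS.
by rewrite rq_mulvM; apply: le_trans (H j jS _) (IHm w).
Qed.

Lemma sqrt_rqB K u v w : pos_kernel K ->
  (forall f, lin u f = lin v f - lin w f) ->
  Num.sqrt (rq K u) <= Num.sqrt (rq K v) + Num.sqrt (rq K w).
Proof.
move=> pK uvw.
have <- : rq K (mulv (fun=> -1) w) = rq K w.
  rewrite /rq qf_mulv; congr complex.Re; apply: eq_qf => z y.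
  by rewrite rmorphN1 mulN1r mulrN1 opprK.
by apply: sqrt_rqD => // f; rewrite uvw lin_mulv linZ mulN1r.
Qed.

Lemma rank1_le K f v : pos_kernel (fun z y => K z y - rank1 f z y) ->
  normc (lin v f) ^+ 2 <= rq K v.
Proof. by move=> /(pos_kernelB_le v); rewrite {1}/rq qf_rank1. Qed.

(* The hypothesis on [K] and [L] says that their reproducing kernel Hilbert
   spaces are orthogonal complements of each other in that of [K + L]. *)
Lemma complementary_kernels K L f (eps : R) :
  pos_kernel K -> pos_kernel L ->
  (forall v (t : R), 0 < t -> exists u w,
     [/\ forall g, lin v g = lin u g + lin w g,
         Num.sqrt (rq K u) <= t & Num.sqrt (rq L w) <= t]) ->
  pos_kernel (fun z y => K z y + L z y - rank1 f z y) -> 0 < eps ->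
  pos_kernel (fun z y => K z y - eps%:C * rank1 f z y) ->
  pos_kernel (fun z y => K z y - rank1 f z y).
Proof.
move=> pK pL split_v Pf eps0 Kf.
have p1 : pos_kernel (rank1 f) by move=> v; rewrite qf_rank1 ler0c sqr_ge0.
apply: pos_kernelB => // v.
rewrite {1}/rq qf_rank1 Re_real -[leRHS]sqr_sqrtr ?pos_rq //.
rewrite ler_sqr ?nnegrE ?sqrtr_ge0 ?normc_ge0 //.
apply: (@ler_addeps _ _ _ ((Num.sqrt eps)^-1 + 2)) => t t0 _.
(* In the limit u is null for K and w is null for L. The eps condition makes f small on u, and on w
   the form of K + L is nearly that of K. *)
have [u [w [vE Ku Lw]]] := split_v v t t0.
have seps : 0 < Num.sqrt eps by rewrite sqrtr_gt0.
have fu : normc (lin u f) <= (Num.sqrt eps)^-1 * t.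
  rewrite ler_pdivlMl //; apply: le_trans Ku.
  rewrite -ler_sqr ?nnegrE ?mulr_ge0 ?sqrtr_ge0 ?normc_ge0 //.
  rewrite exprMn !sqr_sqrtr ?pos_rq ?(ltW eps0) //.
  by have := pos_kernelB_le u Kf; rewrite {1}/rq qfZ qf_rank1 ReZ Re_real.
have Kw : Num.sqrt (rq K w) <= Num.sqrt (rq K v) + t.
  apply: le_trans (_ : Num.sqrt (rq K v) + Num.sqrt (rq K u) <= _).
    by apply: sqrt_rqB => // g; rewrite vE addrAC subrr add0r.
  by rewrite lerD2l.
have fw : normc (lin w f) <= Num.sqrt (rq K v) + 2 * t.
  have fw2 : normc (lin w f) ^+ 2 <= rq K w + rq L w.
    by rewrite -rqD; exact: rank1_le.
  have Kv0 := sqrtr_ge0 (rq K v).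
  have Kw0 := sqrtr_ge0 (rq K w); have Lw0 := sqrtr_ge0 (rq L w).
  rewrite -ler_sqr ?nnegrE ?normc_ge0 //; last by lra.
  apply: le_trans fw2 _; rewrite -(sqr_sqrtr (pos_rq w pK)).
  rewrite -(sqr_sqrtr (pos_rq w pL)).
  move: Kv0 Kw0 Lw0 Kw Lw; move: (Num.sqrt (rq K v)) (Num.sqrt (rq K w))
    (Num.sqrt (rq L w)) => r1 r2 r3; nra.
rewrite vE; apply: le_trans (normcD_le _ _) _.
by move: fu fw; move: (normc _) (normc _) (Num.sqrt _) (_^-1) => *; lra.
Qed.

End Criteria.

(** * The canonical decomposition *)

Section Decomposition.
Variables (R : realType) (d : nat) (n : 'X_{1..d}).
Local Notation C := R[i].
Local Notation E := {mpoly C[d]}.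
Local Notation X := (polydisk R d).
Local Notation dvec := (seq (C * X)).
Variable p : E.
Hypothesis deg_p : mdeg_le n p.
Hypothesis p_neq0 : forall z : 'I_d -> C,
  (forall j, `|z j| <= 1) -> p.@[z] != 0.
Implicit Types (u v w : dvec) (f g h F Q : E) (a : 'X_{1..d}).

Local Notation pt := (reflection n p).

Lemma p_polydisk_neq0 (x : X) : p.@[val x] != 0.
Proof. by apply: p_neq0 => j; exact/ltW/(forallP (valP x)). Qed.

Lemma reflection_torus (z : 'I_d -> C) : (forall j, `|z j| = 1) ->
  pt.@[z] * Num.conj pt.@[z] = p.@[z] * Num.conj p.@[z].
Proof.
move=> z1.
have z0 j : z j != 0 by rewrite -normr_eq0 z1 oner_eq0.
have zinv : (fun j => 1 / Num.conj (z j)) =1 z.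
  move=> j; apply: (mulIf (_ : Num.conj (z j) != 0)).
    by rewrite conjC_eq0.
  by rewrite div1r mulVf ?conjC_eq0 // -normCK z1 expr1n.
rewrite meval_reflection // (meval_eq _ zinv) -!normCK normrM norm_conjC.
rewrite normr_prod big1 ?mul1r // => j _.
by rewrite normrX z1 expr1n.
Qed.

Lemma ip_reflection f g : ip (pt * f) (pt * g) = ip (p * f) (p * g).
Proof.
apply: ip_eq_torus => z z1; rewrite !mevalM !rmorphM /=.
by rewrite mulrACA reflection_torus // mulrACA.
Qed.

Lemma hn_reflection f : hn (pt * f) = hn (p * f).
Proof. by rewrite /hn ip_reflection. Qed.

Definition phi (x : X) : C := pt.@[val x] / p.@[val x].

(** Against multiples of p the adjoint of the rational function [phi] acts through polynomials;
    density then gives access to all of H^2. *)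
Lemma ev_mulv_phi v h : ev (mulv phi v) (p * h) = ev v (pt * h).
Proof.
rewrite /ev lin_mulv; apply: eq_lin => x.
by rewrite !mevalM mulrA divfK // p_polydisk_neq0.
Qed.

Lemma ev_mulv_coord j v h : ev (mulv (coord j) v) h = ev v ('X_j * h).
Proof. by rewrite /ev lin_mulv; apply: eq_lin => x; rewrite mevalM mevalXU. Qed.

Lemma ev_mulv_mono a v h :
  ev (mulv (fun x => mono (val x) a) v) h = ev v ('X_[a] * h).
Proof. by rewrite /ev lin_mulv; apply: eq_lin => x; rewrite mevalM mevalX. Qed.

Definition phi_szego : kernel R d := conj_kernel phi (@szego R d).

Lemma rq_phi_szego v : rq phi_szego v = rq (@szego R d) (mulv phi v).
Proof. by rewrite /rq -qf_mulv. Qed.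

Lemma subspaceT : subspace (fun=> True : Prop) (R := R) (d := d).
Proof. by []. Qed.

Lemma szego_pos : pos_kernel (@szego R d).
Proof. exact: represents_pos subspaceT (@szego_represents R d). Qed.

Lemma phi_szego_pos : pos_kernel phi_szego.
Proof. by apply: pos_conj_kernel; exact: szego_pos. Qed.

Section Fixed.
Variables (S : {set 'I_d}) (kW : kernel R d).

(* The projections to H^2 of the functions z^(-a) p~ Q. *)
Definition shift_space g : Prop := exists a Q,
  (forall j, j \notin S -> a j = 0%N) /\ g = bshift a (pt * Q).

Hypothesis kWP : represents shift_space kW.

(** Common denominators: z^(-a) p~ Q + z^(-b) p~ Q' is z^(-a-b) p~ (z^b Q + z^a Q'). *)
Lemma shift_space_subspace : subspace shift_space.
Proof.
split=> [|c f g [a [Q [a0 ->]]] [b [Q' [b0 ->]]]].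
  exists 0%MM, 0; split=> [j _|]; first by rewrite mnm0E.
  by rewrite mulr0 bshift0.
exists (a + b)%MM, (c *: ('X_[b] * Q) + 'X_[a] * Q'); split=> [j jS|].
  by rewrite mnmDE a0 ?b0.
rewrite mulrDr bshiftD -scalerAr bshiftZ -bshiftDm mulrCA bshiftXK.
by rewrite addmC -bshiftDm mulrCA bshiftXK.
Qed.

Let sW := shift_space_subspace.

Lemma kW_pos : pos_kernel kW.
Proof. exact: represents_pos sW kWP. Qed.

(* By density [F] may be taken to be p h0; then phi F = p~ h0 lies in
   [shift_space], and it is orthogonal to [bshift a (p~ Q)]. *)
Lemma shift_space_ub v a Q F :
  (forall j, j \notin S -> a j = 0%N) ->
  ip (p * Q) ('X_[a] * F) = 0 ->
  2 * complex.Re (ev v (bshift a (pt * Q))) - hn (bshift a (pt * Q)) ^+ 2 +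
  (2 * complex.Re (ev (mulv phi v) F) - hn F ^+ 2) <= rq kW v.
Proof.
move=> a0 orth; set g := bshift a _.
have [B B0 HB] := lin_meval_bounded phi v.
apply: (@ler_addeps _ _ _ (2 * B + 2 * hn (p * Q) + 2 * hn F + 1)) => e e0 e1.
have [h0 hP] := dense_range_outer p_neq0 F e0.
have Wg : shift_space (g + pt * h0).
  apply: subspaceD sW _ _; first by exists a, Q.
  exists 0%MM, h0; split; last by rewrite bshift0.
  by move=> j _; rewrite mnm0E.
have := represents_ub kWP v Wg; rewrite evD ReD hn_sqrD hn_reflection.
rewrite -ev_mulv_phi.
have E1 : complex.Re (ev (mulv phi v) F) <=
    complex.Re (ev (mulv phi v) (p * h0)) + B * e.
  rewrite -lerBlDl -ReB -evB; apply: le_trans (Re_le_normc _) _.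
  rewrite /ev lin_mulv; apply: le_trans (HB _) _.
  by rewrite ler_wpM2l // hn_distC.
(* Moving [bshift a] to the other side and replacing p~ by p leaves <z^a p h0, p Q>. Subtracting z^a
   F costs nothing by [orth], so only the density error remains. *)
have E2 : complex.Re (ip g (pt * h0)) <= hn (p * Q) * e.
  rewrite ip_conj Re_conj /g -ip_bshift mulrCA ip_reflection.
  have -> : ip (p * ('X_[a] * h0)) (p * Q) =
      ip ('X_[a] * (p * h0 - F)) (p * Q).
    rewrite mulrBr ipBl [ip ('X_[a] * F) _]ip_conj orth rmorph0 subr0.
    by rewrite mulrCA.
  apply: le_trans (Re_ip_CS _ _) _; rewrite hn_mulX mulrC.
  by rewrite ler_wpM2l ?hn_ge0.
have E3 : hn (p * h0) <= hn F + e.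
  by rewrite -{1}[p * h0](subrK F) addrC (le_trans (hnD_le _ _)) // lerD2l.
have F0 := hn_ge0 F; have P0 := hn_ge0 (p * h0).
move: E1 E2 E3 F0 P0.
move: (complex.Re _) (complex.Re _) (complex.Re _) (complex.Re _)
  (hn g) (hn (p * h0)) (hn F) (hn (p * Q)) (rq _ _).
by move=> r1 r2 r3 r4 r5 r6 r7 r8 r9 *; nra.
Qed.

(** phi H^2 lies in the closure of W: the case Q = 0 of [shift_space_ub]. *)
Lemma shift_space_co_pos : pos_kernel (fun z y => kW z y - phi_szego z y).
Proof.
apply: pos_kernelB; [exact: kW_pos|exact: phi_szego_pos|move=> v].
rewrite rq_phi_szego; apply: (represents_le (@szego_represents R d)).
move=> F _; have := @shift_space_ub v 0%MM 0 F.
rewrite !mulr0 bshift0 ip0l hn0 expr0n /= subr0 (_ : ev v 0 = 0).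
  by rewrite mulr0 add0r; apply=> // j _; rewrite mnm0E.
by rewrite -(scale0r (0 : E)) evZ mul0r.
Qed.

Lemma shift_space_compl_pos : pos_kernel (fun z y => @szego R d z y - kW z y).
Proof.
apply: pos_kernelB; [exact: szego_pos|exact: kW_pos|move=> v].
apply: (represents_le kWP) => h _.
exact: (represents_ub (@szego_represents R d)).
Qed.

(** W is stable under the backward shift in z_j, hence its complement under z_j. In variational
    form, g = z_j g' + g0; then z_j f + g0 is tested in H^2 and g' in W, and the norms add up to
    those of f and g. *)
Lemma shift_space_compl_contractive j v : j \in S ->
  rq (fun z y => @szego R d z y - kW z y) (mulv (coord j) v) <=
  rq (fun z y => @szego R d z y - kW z y) v.
Proof.
move=> jS; rewrite !rqB.
suff : rq kW v <=
    rq (@szego R d) v + rq kW (mulv (coord j) v) -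
    rq (@szego R d) (mulv (coord j) v).
  by move: (rq _ _) (rq _ _) (rq _ _) (rq _ _) => *; lra.
apply: (represents_le kWP) => g Wg.
suff : rq (@szego R d) (mulv (coord j) v) <=
    rq (@szego R d) v + rq kW (mulv (coord j) v) -
    (2 * complex.Re (ev v g) - hn g ^+ 2).
  by move: (rq _ _) (rq _ _) (rq _ _) => *; lra.
apply: (represents_le (@szego_represents R d)) => f _.
pose g' := bshift U_(j) g; pose g0 := g - 'X_j * g'.
have Wg' : shift_space g'.
  have [a [Q [a0 gE]]] := Wg; exists (U_(j) + a)%MM, Q; split=> [i iS|].
    rewrite mnmDE a0 // mnm1E; case: eqVneq => // ji.
    by rewrite -ji jS in iS.
  by rewrite /g' gE bshiftDm.
have g0K : bshift U_(j) g0 = 0 by rewrite /g0 bshiftB bshiftXK subrr.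
have pyth h : hn ('X_j * h + g0) ^+ 2 = hn h ^+ 2 + hn g0 ^+ 2.
  by rewrite hn_sqrD hn_mulX ip_bshift g0K ip0r mulr0 addr0.
have gE : g = 'X_j * g' + g0 by rewrite addrC subrK.
have := represents_ub kWP (mulv (coord j) v) Wg'.
have := represents_ub (@szego_represents R d) v (h := 'X_j * f + g0) I.
rewrite !ev_mulv_coord pyth {1 2}gE pyth !evD !ReD.
lra.
Qed.

(** z_j maps W into itself, and phi F0 is orthogonal to z_j W when F0 does not involve z_j. With F =
    z_j F1 + F0, the pair z_j g, F0 is tested by [shift_space_ub] and F1 in H^2. *)
Lemma shift_space_co_contractive j v : j \notin S ->
  rq (fun z y => kW z y - phi_szego z y) (mulv (coord j) v) <=
  rq (fun z y => kW z y - phi_szego z y) v.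
Proof.
move=> jS; rewrite !rqB !rq_phi_szego.
set v' := mulv (coord j) v; set vp := mulv phi v; set vp' := mulv phi v'.
suff : rq kW v' <= rq kW v + rq (@szego R d) vp' - rq (@szego R d) vp.
  by move: (rq _ _) (rq _ _) (rq _ _) (rq _ _) => *; lra.
apply: (represents_le kWP) => _ [a [Q [a0 ->]]]; set g := bshift _ _.
suff : rq (@szego R d) vp <= rq kW v + rq (@szego R d) vp' -
    (2 * complex.Re (ev v' g) - hn g ^+ 2).
  by move: (rq _ _) (rq _ _) (rq _ _) => *; lra.
apply: (represents_le (@szego_represents R d)) => F _.
pose F1 := bshift U_(j) F; pose F0 := F - 'X_j * F1.
have F0K : bshift U_(j) F0 = 0 by rewrite /F0 bshiftB bshiftXK subrr.
have FE : F = 'X_j * F1 + F0 by rewrite addrC subrK.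
have pyth : hn F ^+ 2 = hn F1 ^+ 2 + hn F0 ^+ 2.
  by rewrite {1}FE hn_sqrD hn_mulX ip_bshift F0K ip0r mulr0 addr0.
have disj i : U_(j)%MM i = 0%N \/ a i = 0%N.
  rewrite mnm1E; case: eqVneq => [<-|_]; last by left.
  by right; exact: a0.
have disj' i : a i = 0%N \/ U_(j)%MM i = 0%N by case: (disj i); [right|left].
have XgE : bshift a (pt * ('X_j * Q)) = 'X_j * g by rewrite mulrCA bshiftXC.
have orth : ip (p * ('X_j * Q)) ('X_[a] * F0) = 0.
  by rewrite mulrCA ip_bshift bshiftXC // F0K mulr0 ip0r.
have := shift_space_ub v a0 orth; rewrite XgE hn_mulX -/vp.
have := represents_ub (@szego_represents R d) vp' (h := F1) I.
rewrite pyth {1}FE (evD vp ('X_j * F1) F0) (ReD _ (ev vp F0)) ev_mulv_coord.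
have -> : ev vp' F1 = ev vp ('X_j * F1).
  rewrite /ev !lin_mulv; apply: eq_lin => x.
  by rewrite mevalM mevalXU /coord mulrCA.
clearbody g vp' vp v' F0 F1; lra.
Qed.

(** u approximates the projection of v to the closure of W and w is v - u. So u has almost no part
    in the complement of W, and w almost vanishes on W; two errors of size t / 2 meet in w. *)
Lemma shift_space_split v (t : R) : 0 < t -> exists u w,
  [/\ forall f : X -> C, lin v f = lin u f + lin w f,
      Num.sqrt (rq (fun z y => @szego R d z y - kW z y) u) <= t &
      Num.sqrt (rq (fun z y => kW z y - phi_szego z y) w) <= t].
Proof.
move=> t0; have e0 : 0 < t / 2 by rewrite divr_gt0.
have [g [Wg Hv _]] := represents_near kWP v e0.
have [u Hu] := approx_poly g e0.
exists u, (v ++ mulv (fun=> -1) u); split=> [f||].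
- by rewrite lin_cat lin_mulv linZ mulN1r addrCA subrr addr0.
- rewrite -[leRHS]gtr0_norm // -sqrtr_sqr ler_wsqrtr // rqB.
  have := dual_norm_ge (ltW e0) Hu; have := represents_ub kWP u Wg.
  by move: (rq _ _) (rq _ _) (complex.Re _) (hn g) => *; nra.
rewrite -[leRHS]gtr0_norm // -sqrtr_sqr ler_wsqrtr // rqB.
have := pos_rq (v ++ mulv (fun=> -1) u) phi_szego_pos.
suff : rq kW (v ++ mulv (fun=> -1) u) <= t ^+ 2.
  by move: (rq _ _) (rq _ _) => *; lra.
apply: (represents_le_bound kWP (ltW t0)) => h Wh.
have -> : ev (v ++ mulv (fun=> -1) u) h =
    (ev v h - ip h g) - (ev u h - ip h g).
  by rewrite {1}/ev lin_cat lin_mulv linZ mulN1r /ev; ring.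
apply: le_trans (normcB_le _ _) _; have := Hv h Wh; have := Hu h.
by move: (normc _) (normc _) (hn h) => *; lra.
Qed.

(* For [g = bshift a u], the functional [nu] approximates z^a v + (u - z^a g),
   whose backward shift by a is v and whose distance to u is that of v to g. *)
Lemma shift_space_maximal (K : kernel R d) : pos_kernel K ->
  (forall j, j \in S -> forall w, rq K (mulv (coord j) w) <= rq K w) ->
  pos_kernel (fun z y => (@szego R d z y - phi_szego z y) - K z y) ->
  pos_kernel (fun z y => (@szego R d z y - kW z y) - K z y).
Proof.
move=> pK Kcontr KP.
have K_le w : rq K w <= rq (@szego R d) w - rq (@szego R d) (mulv phi w).
  by rewrite -rq_phi_szego -rqB; exact: pos_kernelB_le.
apply: pos_kernelB => //; first exact: shift_space_compl_pos.
move=> v; rewrite rqB.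
suff : rq kW v <= rq (@szego R d) v - rq K v.
  by move: (rq _ _) (rq _ _) (rq _ _) => *; lra.
apply: (represents_le kWP) => _ [a [Q [a0 ->]]].
set u := pt * Q; set g := bshift a u.
(* [A] is the squared distance from v to g. The chain to come is: K at v is nearly K at [nua], which
   is at most K at [nu], which is nearly at most [A]. *)
pose A := rq (@szego R d) v - 2 * complex.Re (ev v g) + hn g ^+ 2.
have A0 : 0 <= A.
  have := represents_ub (@szego_represents R d) v (h := g) I; rewrite /A.
  by move: (rq _ _) (complex.Re _) => *; lra.
suff : rq K v <= A.
  by rewrite /A; move: (rq _ _) (rq _ _) (complex.Re _) => *; lra.
rewrite -(sqr_sqrtr A0) -(sqr_sqrtr (pos_rq v pK)).
rewrite ler_sqr ?nnegrE ?sqrtr_ge0 //.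
apply: (@ler_addeps _ _ _ 4) => e e0 _.
have [F [_ HF _]] := represents_near (@szego_represents R d) v e0.
pose Y := 'X_[a] * F + u - 'X_[a] * g.
have [nu Hnu] := approx_poly Y e0.
pose nua := mulv (fun x => mono (val x) a) nu.
have Hnua h : normc (ev nua h - ip h F) <= e * hn h.
  have -> : ip h F = ip ('X_[a] * h) Y.
    by rewrite ip_bshift /Y bshiftB bshiftD !bshiftXK -/g addrK.
  by rewrite /nua ev_mulv_mono -(hn_mulX a h); exact: Hnu.
pose w := v ++ mulv (fun=> -1) nua.
have linw (f : X -> C) : lin w f = lin v f - lin nua f.
  by rewrite lin_cat [in LHS]lin_mulv linZ mulN1r.
have sw : Num.sqrt (rq K w) <= 2 * e.
  have e2 : 0 < 2 * e by rewrite mulr_gt0.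
  rewrite -[leRHS]gtr0_norm // -sqrtr_sqr ler_wsqrtr //.
  apply: le_trans (K_le w) _.
  have := pos_rq w phi_szego_pos; rewrite rq_phi_szego.
  suff : rq (@szego R d) w <= (2 * e) ^+ 2.
    by move: (rq _ _) (rq _ _) => *; lra.
  apply: (represents_le_bound (@szego_represents R d) (ltW e2)) => h _.
  have -> : ev w h = (ev v h - ip h F) - (ev nua h - ip h F).
    by rewrite {1}/ev linw /ev; ring.
  apply: le_trans (normcB_le _ _) _; have := HF h I; have := Hnua h.
  by move: (normc _) (normc _) (hn h) => *; lra.
have FgA : hn (F - g) <= e + Num.sqrt A.
  have dn h : normc (ev v h - ip h g) <= Num.sqrt A * hn h.
    by apply: dual_norm_le; [exact: sqrtr_ge0 | rewrite -/A sqr_sqrtr ?lexx].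
  have [->|nz] := eqVneq (hn (F - g)) 0.
    by rewrite addr_ge0 ?sqrtr_ge0 // ltW.
  have hp : 0 < hn (F - g) by rewrite lt_def nz hn_ge0.
  rewrite -(ler_pM2r hp) -expr2 hn_sqr; apply: le_trans (Re_le_normc _) _.
  have -> : ip (F - g) (F - g) =
      (ev v (F - g) - ip (F - g) g) - (ev v (F - g) - ip (F - g) F).
    by rewrite [ip _ (F - g)]ipBr; ring.
  apply: le_trans (normcB_le _ _) _.
  rewrite mulrDl addrC; apply: lerD; [exact: HF | exact: dn].
have snu : Num.sqrt (rq K nua) <= 2 * e + Num.sqrt A.
  have c0 : 0 <= e + hn (Y - u) by rewrite addr_ge0 ?hn_ge0 // ltW.
  have Yu : hn (Y - u) = hn (F - g).
    by rewrite /Y addrAC addrK -mulrBr hn_mulX.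
  have bound h : normc (ev nu h - ip h u) <= (e + hn (Y - u)) * hn h.
    have -> : ev nu h - ip h u = (ev nu h - ip h Y) + ip h (Y - u).
      by rewrite (ipBr Y u h) addrA subrK.
    apply: le_trans (normcD_le _ _) _; rewrite mulrDl lerD //.
    by rewrite mulrC ip_CS.
  (* K at nu is at most the Szego form at nu minus that at [mulv phi nu]. Testing the latter at p Q
     turns this into the squared distance from nu to u, because |p Q| = |p~ Q|. *)
  have := dual_norm_ge c0 bound.
  have := represents_ub (@szego_represents R d) (mulv phi nu) (h := p * Q) I.
  rewrite ev_mulv_phi -hn_reflection -/u => ub1 ub2.
  have nu2 : rq K nua <= (e + hn (Y - u)) ^+ 2.
    apply: le_trans (contractive_mono_le nu Kcontr a0) _.
    apply: le_trans (K_le nu) _; move: ub1 ub2.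
    by move: (rq _ _) (rq _ _) (complex.Re _) (_ ^+ 2) (_ ^+ 2) => *; lra.
  apply: (@le_trans _ _ (e + hn (Y - u))).
    by rewrite -[leRHS]ger0_norm // -sqrtr_sqr ler_wsqrtr.
  by rewrite Yu; move: FgA; move: (hn _) (Num.sqrt _) => *; lra.
apply: le_trans (_ : Num.sqrt (rq K nua) + Num.sqrt (rq K w) <= _).
  by apply: sqrt_rqD => // f; rewrite linw addrC subrK.
by move: snu sw; move: (Num.sqrt _) (Num.sqrt _) (Num.sqrt _) => *; lra.
Qed.

End Fixed.
End Decomposition.

(** * Conjugation by p: from kernels in H^2 to kernels below P *)

Section Transport.
Variables (R : realType) (d : nat).
Local Notation C := R[i].
Local Notation X := (polydisk R d).
Implicit Types (K L P : kernel R d) (k f : X -> C).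

Lemma conj_kernelK k K z y : (forall x, k x != 0) ->
  conj_kernel (fun x => (k x)^-1) (conj_kernel k K) z y = K z y.
Proof.
move=> k0; rewrite /conj_kernel fmorphV /= !mulrA mulVf // mul1r.
by rewrite mulfK // conjC_eq0.
Qed.

Lemma conj_kernelB k K L c z y :
  conj_kernel k (fun z y => K z y - c * L z y) z y =
  conj_kernel k K z y - c * conj_kernel k L z y.
Proof. by rewrite /conj_kernel; move: (Num.conj _) => w; ring. Qed.

(** Conjugation by a nowhere vanishing k preserves the order and takes [rank1] of f / k to
    [rank1 f], so the condition for f reduces to that for f / k. *)
Lemma P_kernel_conj k K L P : (forall x, k x != 0) ->
  pos_kernel K -> pos_kernel L ->
  (forall f (eps : R), pos_kernel (fun z y => K z y + L z y - rank1 f z y) ->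
     0 < eps -> pos_kernel (fun z y => K z y - eps%:C * rank1 f z y) ->
     pos_kernel (fun z y => K z y - rank1 f z y)) ->
  (forall z y, P z y = conj_kernel k (fun z y => K z y + L z y) z y) ->
  P_kernel P (conj_kernel k K).
Proof.
move=> k0 pK pL compl PE; split.
- apply/psd_kernelP; apply: (eq_pos_kernel _ (pos_conj_kernel k pL)) => z y.
  by rewrite PE /conj_kernel -mulrBl -mulrBr addrAC subrr add0r.
- exact/psd_kernelP/pos_conj_kernel.
move=> f /psd_kernelP Pf [eps eps0 /psd_kernelP Kf]; apply/psd_kernelP.
pose f' x := (k x)^-1 * f x.
have rank1E z y : rank1 f' z y = (k z)^-1 * rank1 f z y * Num.conj (k y)^-1.
  by rewrite /rank1 /f' rmorphM /= mulrACA mulrAC !mulrA.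
have {}compl : pos_kernel (fun z y => K z y - rank1 f' z y).
  apply: (compl f' eps) => //.
    apply: (eq_pos_kernel _ (pos_conj_kernel (fun x => (k x)^-1) Pf)) => z y.
    rewrite /conj_kernel mulrBr mulrBl -rank1E PE.
    by rewrite -[in RHS](conj_kernelK (fun z y => K z y + L z y) z y k0).
  apply: (eq_pos_kernel _ (pos_conj_kernel (fun x => (k x)^-1) Kf)) => z y.
  by rewrite conj_kernelB conj_kernelK // rank1E.
apply: (eq_pos_kernel _ (pos_conj_kernel k compl)) => z y.
rewrite /conj_kernel mulrBr mulrBl rank1E; congr (_ - _).
rewrite fmorphV /= !mulrA divff // mul1r divfK //.
by rewrite conjC_eq0.
Qed.

Lemma j_contractive_conj j k K : pos_kernel K ->
  (forall v, rq K (mulv (coord j) v) <= rq K v) ->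
  j_contractive j (conj_kernel k K).
Proof.
move=> pK contr; split; first exact/psd_kernelP/pos_conj_kernel.
apply/psd_kernelP.
apply: (eq_pos_kernel _ (pos_conj_kernel k (contractive_kernel pK contr))).
by move=> z y; rewrite /conj_kernel mulrCA !mulrA.
Qed.

Lemma conj_j_contractive_le j k K v : j_contractive j K ->
  rq (conj_kernel k K) (mulv (coord j) v) <= rq (conj_kernel k K) v.
Proof.
move=> [_ /psd_kernelP pK]; apply: contractive_le.
apply: (eq_pos_kernel _ (pos_conj_kernel k pK)) => z y.
by rewrite /conj_kernel mulrCA !mulrA.
Qed.

Lemma Pker_conj (n : 'X_{1..d}) (p : {mpoly C[d]}) z y :
  (forall x : X, p.@[val x] != 0) ->
  Pker n p z y = conj_kernel (fun x => p.@[val x])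
    (fun z y => @szego R d z y - phi_szego n p z y) z y.
Proof.
move=> p0; rewrite /Pker /phi_szego /conj_kernel /phi fmorph_div /=.
have aux (r q1 t1 c2 d2 : C) : q1 != 0 -> c2 != 0 ->
    (q1 * c2 - t1 * d2) * r = q1 * (r - t1 / q1 * r * (d2 / c2)) * c2.
  by move=> ? ?; field; apply/andP.
by apply: aux; [exact: p0 | rewrite conjC_eq0; exact: p0].
Qed.

End Transport.

(* [set0] is again the empty set of a [finType]. *)
Import mathcomp.boot.finset.

Theorem theorem1p5 (R : realType) (d : nat) (d_gt0 : (0 < d)%N)
    (n : 'X_{1..d}) (p : {mpoly R[i][d]})
    (deg_p : mdeg_le n p)
    (p_neq0 : forall z : 'I_d -> R[i],
       (forall j, `|z j| <= 1) -> p.@[z] != 0) :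
  exists K L : {set 'I_d} -> kernel R d,
    [/\ forall S : {set 'I_d}, S != set0 -> S \proper [set: 'I_d] ->
          [/\ S_contractive S (K S), P_kernel (Pker n p) (K S),
              S_contractive S (L S) & P_kernel (Pker n p) (L S)],
        forall S T : {set 'I_d}, S != set0 -> T != set0 ->
          [disjoint S & T] -> S :|: T = [set: 'I_d] ->
          forall z w, Pker n p z w = K S z w + L T z w
      & forall S : {set 'I_d}, S != set0 -> S \proper [set: 'I_d] ->
          forall K' : kernel R d, psd_kernel K' -> S_contractive S K' ->
            kernel_ge (Pker n p) K' -> kernel_ge (K S) K'].
Proof.
pose k (x : polydisk R d) := p.@[val x].
have k0 x : k x != 0 by exact: p_polydisk_neq0.
pose s := @szego R d; pose ps := phi_szego n p.
have [kW kWP] := choice (fun S : {set 'I_d} =>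
  kernel_exists (shift_space_subspace n p S)).
pose K0 S : kernel R d := fun z y => s z y - kW S z y.
pose L0 S : kernel R d := fun z y => kW S z y - ps z y.
have pK S : pos_kernel (K0 S) by exact: shift_space_compl_pos (kWP S).
have pL S : pos_kernel (L0 S) by exact: shift_space_co_pos (kWP S).
have PE S z y : Pker n p z y =
    conj_kernel k (fun z y => K0 S z y + L0 S z y) z y.
  rewrite Pker_conj // /conj_kernel /K0 /L0; congr (_ * _ * _).
  by rewrite addrA subrK.
exists (fun S => conj_kernel k (K0 S)), (fun S => conj_kernel k (L0 (~: S))).
split=> [S _ _|S T _ _ dST ST z y
  |S _ _ K' /psd_kernelP pK' cK' /psd_kernelP PK'].
- split.
  + move=> j jS; apply: j_contractive_conj => // v.
    exact: shift_space_compl_contractive (kWP S) _ _ jS.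
  + apply: (P_kernel_conj k0 (pK S) (pL S)) (PE S) => f eps.
    apply: complementary_kernels => // v t.
    exact: shift_space_split (kWP S) _ _.
  + move=> j jS; apply: j_contractive_conj => // v.
    by apply: shift_space_co_contractive (kWP _) _ _ _; rewrite ?inE ?negbK.
  (* For the space of L the two complementary kernels exchange roles, and with them u and w. *)
  apply: (P_kernel_conj k0 (pL (~: S)) (pK (~: S))) => [f eps|z y]; last first.
    by rewrite (PE (~: S)) /conj_kernel addrC.
  apply: complementary_kernels => // v t t0.
  have [u [w [vE uK wL]]] := shift_space_split (kWP (~: S)) v t0.
  by exists w, u; split=> // f'; rewrite vE addrC.
(* Both summands then come from the same W, whose kernel cancels. *)
- have -> : ~: T = S.
    apply/setP => i; move/setP/(_ i): ST; rewrite !inE.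
    case: (boolP (i \in S)) => [iS _|_ /= ->//].
    by rewrite (disjointFr dST iS).
  by rewrite (PE S) /conj_kernel mulrDr mulrDl.
(* K' is divided by p(z) conj(p(w)), compared with the kernels below [s - ps] in H^2, and multiplied
   back. *)
apply/psd_kernelP; pose ki x := (k x)^-1.
have pK0 : pos_kernel (conj_kernel ki K') by exact: pos_conj_kernel.
have max : pos_kernel (fun z y => K0 S z y - conj_kernel ki K' z y).
  apply: (shift_space_maximal deg_p p_neq0 (kWP S) pK0).
    by move=> j jS w; apply: conj_j_contractive_le; exact: cK'.
  apply: (eq_pos_kernel _ (pos_conj_kernel ki PK')) => z y.
  rewrite {1}/conj_kernel mulrBr mulrBl; congr (_ - _).
  rewrite Pker_conj //.
  by rewrite -[RHS](conj_kernelK (fun z y => s z y - ps z y) z y k0).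
apply: (eq_pos_kernel _ (pos_conj_kernel k max)) => z y.
rewrite {1}/conj_kernel mulrBr mulrBl; congr (_ - _).
rewrite /conj_kernel /ki fmorphV /= !mulrA divff // mul1r divfK //.
by rewrite conjC_eq0.
Qed.
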